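(* Let $L/K$ be a finite (not necessarily Galois) extension of $p$-adic fields with Galois closure $E$, let $G=\mathrm{Gal}(E/K)$, and let $H = E[N]^G$ be a commutative Hopf algebra giving a Hopf-Galois structure on $L/K$, where $N$ is a regular subgroup of $\mathrm{Perm}(X)$ normalised by $\lambda(G)$. Suppose that $p\nmid [L:K]$. Let $\mathfrak{A}_H = \{h \in H \mid h\cdot x \in \mathfrak{O}_L \text{ for all } x \in \mathfrak{O}_L\}$. Then $\mathfrak{A}_H = \mathfrak{O}_E[N]^G$ and $\mathfrak{O}_L$ is a free $\mathfrak{A}_H$-module.
   Context: A $p$-adic field is a finite extension of $\mathbb{Q}_p$; $\mathfrak{O}_L,\mathfrak{O}_E$ denote valuation rings. Hopf-Galois structures: a finite-dimensional $K$-Hopf algebra $H$ (counit $\varepsilon$, comultiplication $\Delta(h)=\sum_{(h)} h_{(1)}\otimes h_{(2)}$) gives a Hopf-Galois structure on $L/K$ if $L$ is an $H$-module with $h\cdot(st)=\sum_{(h)}(h_{(1)}\cdot s)(h_{(2)}\cdot t)$, $h\cdot 1=\varepsilon(h)1$, and the map $L\otimes_K H\to \mathrm{End}_K(L)$, $s\otimes h\mapsto (t\mapsto s(h\cdot t))$, is bijective. Greither–Pareigis description for a finite separable extension $L/K$ with normal closure $E$: let $G=\mathrm{Gal}(E/K)$, $G'=\mathrm{Gal}(E/L)$, $X=\{gG'\mid g\in G\}$, $\overline{x}=xG'$, and $\lambda:G\to\mathrm{Perm}(X)$, $\lambda(g)(\overline{x})=\overline{gx}$. A subgroup $N\le\mathrm{Perm}(X)$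 is regular if $|N|=|X|$ and $N$ is transitive on $X$. The Hopf-Galois structures on $L/K$ correspond bijectively to regular subgroups $N$ normalised by $\lambda(G)$. The Hopf algebra corresponding to $N$ is $H=E[N]^G$, the fixed points of $G$ acting on $E[N]$ simultaneously on the coefficients by Galois automorphisms and on $N$ by $n\mapsto\lambda(g)n\lambda(g)^{-1}$, with Hopf structure maps inherited from $E[N]$ (so $H$ is commutative iff $N$ is abelian); it acts on $L$ by $\left(\sum_{n} c_n n\right)\cdot x=\sum_n c_n\,(n^{-1}(\overline{1_G}))x$, where a coset $gG'$ acts on $x\in L$ by $g(x)$. $\mathfrak{O}_E[N]^G=\mathfrak{O}_E[N]\cap E[N]^G$. *)

(* Defs.v *)
From mathcomp Require Import all_boot all_order all_algebra all_fingroup.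
From mathcomp Require Import all_solvable all_field.

Set Implicit Arguments.
Unset Strict Implicit.
Unset Printing Implicit Defensive.

Import Order.TTheory GRing.Theory Num.Theory.
Local Open Scope ring_scope.

(* Valuations are additive and rat-valued: every value of the extension of   *)
(* v_p to a finite extension of Q_p is rational.  The value at 0 stands for  *)
(* +oo; the rational v 0 is junk and is never used.                          *)
Record valuation (F : fieldType) (v : F -> rat) : Prop := Valuation {
  valuationM : forall x y, x != 0 -> y != 0 -> v (x * y) = v x + v y;
  valuationD : forall x y, x != 0 -> y != 0 -> x + y != 0 ->
    Num.min (v x) (v y) <= v (x + y) }.

(* v x >= k, with v 0 = +oo *)
Definition val_ge (F : fieldType) (v : F -> rat) (k : rat) (x : F) : bool :=
  (x == 0) || (k <= v x).

Definition val_ring (F : fieldType) (v : F -> rat) : pred F := val_ge v 0.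

Definition val_complete (F : fieldType) (v : F -> rat) : Prop :=
  forall u : nat -> F,
    (forall k : nat, exists M : nat, forall m n : nat,
       (M <= m)%N -> (M <= n)%N -> val_ge v k%:R (u m - u n)) ->
    exists l : F, forall k : nat, exists M : nat, forall n : nat,
      (M <= n)%N -> val_ge v k%:R (u n - l).

Definition padic_val (p : nat) (q : rat) : rat :=
  (logn p `|numq q|%N)%:R - (logn p `|denq q|%N)%:R.

(* (F, v) is the completion of the rationals at the prime p; this determines *)
(* (F, v) up to a unique isomorphism.                                        *)
Record is_Qp (p : nat) (F : fieldType) (v : F -> rat) : Prop := IsQp {
  Qp_pchar0 : [pchar F] =i pred0;
  Qp_valuation : valuation v;
  Qp_padic : forall q : rat, q != 0 -> v (ratr q) = padic_val p q;
  Qp_dense : forall (x : F) (k : nat),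
    exists q : rat, val_ge v k%:R (x - ratr q);
  Qp_complete : val_complete v }.

(* For a p-adic field K and an extension E of K: v is the extension to E of  *)
(* the valuation v0 of Q_p.                                                  *)
Definition extends_valuation (Qp : fieldType) (v0 : Qp -> rat)
    (K : fieldExtType Qp) (E : fieldExtType K) (v : E -> rat) : Prop :=
  valuation v /\ forall a : Qp, a != 0 -> v ((a%:A : K)%:A) = v0 a.

Definition galois_closure (K : fieldType) (E : splittingFieldType K)
    (L : {subfield E}) : Prop :=
  galois 1 {:E} /\
  forall M : {subfield E}, (L <= M)%VS -> galois 1 M -> M = {:E}%VS :> {vspace E}.

Section GreitherPareigis.

Variables (K : fieldType) (E : splittingFieldType K) (L : {subfield E}).

Local Notation G := 'Gal({:E} / 1%AS)%g.
Local Notation G' := 'Gal({:E} / L)%g.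

(* The library multiplies Galois automorphisms and permutations in           *)
(* diagrammatic order: (s * t) x = t (s x).  With products written as        *)
(* composites, the left coset g G' = {g \o h | h in G'} is thus the          *)
(* library's G' :* g, the left translation by g is A |-> A :* g, and the     *)
(* conjugate s n s^-1 is the library's n ^ s = s^-1 * n * s.                 *)
Definition gpX := {A : {set gal_of {:E}} | A \in rcosets G' G}.

Lemma in_galG (g : gal_of {:E}) : g \in G.
Proof.
rewrite gal_kHom ?sub1v //; apply/kAHomP=> a /fixed_gal; apply.
  exact: sub1v.
by rewrite gal_kAut ?sub1v // kAut1E limg_gal.
Qed.

Lemma gpX_rcoset (g : gal_of {:E}) : (G' :* g)%g \in rcosets G' G.
Proof. by rewrite -rcosetE imset_f ?in_galG. Qed.

Definition gp_class (g : gal_of {:E}) : gpX :=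
  exist (fun A => A \in rcosets G' G) _ (gpX_rcoset g).

Lemma gpX_mulr (A : gpX) (g : gal_of {:E}) : (val A :* g)%g \in rcosets G' G.
Proof.
by case: A => _ /= /rcosetsP[h _ ->]; rewrite -rcosetM gpX_rcoset.
Qed.

Definition gp_translate (g : gal_of {:E}) (A : gpX) : gpX :=
  exist (fun B => B \in rcosets G' G) _ (gpX_mulr A g).

Lemma gp_translate_inj (g : gal_of {:E}) : injective (gp_translate g).
Proof. by move=> A B /(congr1 val) /= /rcoset_inj/val_inj. Qed.

Definition gp_lambda (g : gal_of {:E}) : {perm gpX} := perm (@gp_translate_inj g).

Definition gp_regular (N : {group {perm gpX}}) : Prop :=
  #|N| = #|{: gpX}| /\ [transitive N, on setT | 'P]%g.

Definition gp_normalised (N : {group {perm gpX}}) : Prop :=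
  (gp_lambda @: G \subset 'N(N))%g.

(* The class of g acts on L as g does; all its members agree on L. *)
Definition gp_coset_act (A : gpX) (x : E) : E := repr (val A) x.

Variable N : {group {perm gpX}}.

(* E[N], the element \sum_n c_n n being the function n |-> c_n *)
Definition grp_alg := {ffun [subg N] -> E}.

(* The product of N is composition of permutations, n1 \o n2 = n2 * n1. *)
Definition grp_alg_mul (a b : grp_alg) : grp_alg :=
  [ffun n => \sum_n1 \sum_(n2 | (n2 * n1)%g == n) a n1 * b n2].

(* g . \sum_n c_n n = \sum_n g(c_n) (lambda(g) n lambda(g)^-1) *)
Definition grp_alg_gal (g : gal_of {:E}) (c : grp_alg) : grp_alg :=
  [ffun m : [subg N] =>
     \sum_(n : [subg N] | (sgval n ^ gp_lambda g)%g == sgval m) g (c n)].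

(* H = E[N]^G *)
Definition gpH (c : grp_alg) : Prop :=
  forall g, g \in G -> grp_alg_gal g c = c.

Definition gpH_commutative : Prop :=
  forall a b, gpH a -> gpH b -> grp_alg_mul a b = grp_alg_mul b a.

Definition gpH_act (c : grp_alg) (x : E) : E :=
  \sum_(n : [subg N]) c n * gp_coset_act ((sgval n)^-1%g (gp_class 1%g)) x.

Variable v : E -> rat.

Definition int_ring_L : pred E := fun x => (x \in L) && val_ring v x.

(* O_E[N]^G *)
Definition int_grp_alg_fixed (c : grp_alg) : Prop :=
  (forall n, val_ring v (c n)) /\ gpH c.

Definition assoc_order (c : grp_alg) : Prop :=
  gpH c /\ forall x, int_ring_L x -> int_ring_L (gpH_act c x).

(* O_L has a basis over A_H; as O_L is finitely generated over the subring   *)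
(* O_K of A_H, every basis is finite.                                        *)
Definition free_over_assoc_order : Prop :=
  exists (r : nat) (b : 'I_r -> E),
    (forall i, int_ring_L (b i)) /\
    forall x, int_ring_L x ->
      exists! a : {ffun 'I_r -> grp_alg},
        (forall i, assoc_order (a i)) /\ x = \sum_i gpH_act (a i) (b i).

End GreitherPareigis.

(* Main.v *)
From HB Require Import structures.
Require Import Defs.
From mathcomp Require Import all_boot all_order all_algebra all_fingroup.
From mathcomp Require Import all_solvable all_field.
From mathcomp Require Import ring lra zify.
From Stdlib Require Import Classical ClassicalEpsilon.

(* Integrality.  As p does not divide |N|, n |-> n^p permutes the abelian     *)
(* group N, so (\sum_n c_n n)^p = \sum_n c_n^p n^p modulo p shows that the    *)
(* Gauss valuation c |-> min_n v (c_n) on E[N] is power-multiplicative.  The  *)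
(* associated order is bounded for it (independence of the embeddings of L)   *)
(* and closed under powers, so it lies in O_E[N].                             *)
(*   Freeness.  x |-> \sum_n (n (1 G') x) n embeds L in E[N] compatibly with  *)
(* H; an x of L generates L over H iff its image is a unit.  If x in O_L is a *)
(* generator and h x in O_L with h in H not integral, scale a power of h to   *)
(* Gauss valuation 0; by finiteness of residue rings a power e of the result  *)
(* is idempotent up to a high power of p, and (e h + 1 - e) x generates a     *)
(* strictly larger lattice in O_L.  Lattices containing a fixed one have      *)
(* bounded index, so this stops, and then O_L = A_H x.                        *)

Set Implicit Arguments.
Unset Strict Implicit.
Unset Printing Implicit Defensive.

Import Order.TTheory GRing.Theory Num.Theory.
Local Open Scope ring_scope.

(** * Valuations and norm equivalence *)

(** Commutativity of [H] forces [N] to be abelian ([gpH_commutative_mulC], by independence of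
    automorphisms), so everything takes place in the commutative ring E[N], where [cge v k c] bounds
    the Gauss valuation of [c] from below by [k]. A complete valuation has at most one extension to
    a finite extension ([val_extension_unique]), so Galois automorphisms preserve [v] ([val_gal]),
    and x in L is integral iff [gembed x] is ([cge_embed]). As [gembed] turns the action of H into
    multiplication ([gembed_act]), O_E[N]^G stabilises O_L.

    Conversely, a dual basis for the embeddings of L recovers the coefficients of c in H from
    finitely many values c.w_j, so a single bound holds on the whole associated order
    ([assoc_order_bounded]), in particular for all powers of each element. The Gauss valuation is
    power-multiplicative because p is prime to |N| = [L:K] ([cge_root]), so the bound for c can be
    divided by arbitrarily large exponents, which makes c integral ([order_integral]).

    For freeness, L has a generator over H whose image in E[N] is a unit ([unit_embed]), and
    quotients by such a unit lie in H ([gpH_div]). If an integral y is not an integral multiple of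
    the generator u, an approximate idempotent cuts out the part of E[N] where y/u is largest;
    replacing u by y there and keeping it elsewhere gives a generator of a strictly larger lattice
    ([better_generator]). Finiteness of residue rings stops this process ([free_lattice]) at a
    generator of O_L. *)

Section ValuationTheory.

Variables (F : fieldType) (v : F -> rat).
Hypothesis hv : valuation v.

Lemma valuation1 : v 1 = 0.
Proof.
have := valuationM hv (oner_neq0 F) (oner_neq0 F); rewrite mulr1 => h; lra.
Qed.

Lemma valuationX x n : x != 0 -> v (x ^+ n) = v x *+ n.
Proof.
move=> x0; elim: n => [|n IHn]; first by rewrite expr0 mulr0n valuation1.
by rewrite exprS (valuationM hv) ?expf_neq0 // IHn mulrS.
Qed.

Lemma valuationN1 : v (-1) = 0.
Proof.
have n0 : (-1 : F) != 0 by rewrite oppr_eq0 oner_neq0.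
have := valuationM hv n0 n0; rewrite mulrNN mulr1 valuation1 => h; lra.
Qed.

Lemma valuationV x : x != 0 -> v x^-1 = - v x.
Proof.
move=> x0; have := valuationM hv x0 (invr_neq0 x0).
by rewrite mulfV // valuation1 => h; lra.
Qed.

Lemma val_ge0 k : val_ge v k 0.
Proof. by rewrite /val_ge eqxx. Qed.

Lemma val_geE k x : x != 0 -> val_ge v k x = (k <= v x).
Proof. by rewrite /val_ge => /negPf->. Qed.

Lemma val_geW k l x : l <= k -> val_ge v k x -> val_ge v l x.
Proof.
by rewrite /val_ge => lk /orP[->//|h]; rewrite (le_trans lk h) orbT.
Qed.

Lemma val_geM k l x y : val_ge v k x -> val_ge v l y -> val_ge v (k + l) (x * y).
Proof.
have [->|x0] := eqVneq x 0; first by rewrite mul0r => _ _; apply: val_ge0.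
have [->|y0] := eqVneq y 0; first by rewrite mulr0 => _ _; apply: val_ge0.
by rewrite !val_geE ?mulf_neq0 // (valuationM hv) //; apply: lerD.
Qed.

Lemma val_geMl k l x y : k <= v x -> val_ge v l y -> val_ge v (k + l) (x * y).
Proof. by move=> h; apply: val_geM; rewrite /val_ge h orbT. Qed.

Lemma val_geN k x : val_ge v k (- x) = val_ge v k x.
Proof.
have N y : val_ge v k y -> val_ge v k (- y).
  by rewrite -mulN1r -{2}[k]add0r; apply: val_geMl; rewrite valuationN1.
by apply/idP/idP => /N; rewrite ?opprK.
Qed.

Lemma val_geD k x y : val_ge v k x -> val_ge v k y -> val_ge v k (x + y).
Proof.
have [->|x0] := eqVneq x 0; first by rewrite add0r.
have [->|y0] := eqVneq y 0; first by rewrite addr0.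
have [->|s0] := eqVneq (x + y) 0; first by rewrite val_ge0.
rewrite !val_geE // => h1 h2; apply: le_trans (valuationD hv x0 y0 s0).
by rewrite le_min h1.
Qed.

Lemma val_geB k x y : val_ge v k x -> val_ge v k y -> val_ge v k (x - y).
Proof. by move=> hx hy; rewrite val_geD // val_geN. Qed.

Lemma val_ge_sum k (I : Type) (r : seq I) (P : pred I) (f : I -> F) :
  (forall i, P i -> val_ge v k (f i)) -> val_ge v k (\sum_(i <- r | P i) f i).
Proof.
by move=> h; elim/big_ind: _ => //; [apply: val_ge0|apply: val_geD].
Qed.

Lemma val_ge_nat n : val_ge v 0 n%:R.
Proof.
rewrite -[n%:R]/(1 *+ n); elim: n => [|n IHn]; first by rewrite val_ge0.
by rewrite mulrS val_geD // /val_ge valuation1 lexx orbT.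
Qed.

Lemma val_ge_Vl k x y : x != 0 -> val_ge v k (x * y) = val_ge v (k - v x) y.
Proof.
move=> x0; have [->|y0] := eqVneq y 0; first by rewrite mulr0 !val_ge0.
by rewrite !val_geE ?mulf_neq0 // (valuationM hv) // lerBlDl.
Qed.

Lemma val_ge_all x : (forall k : nat, val_ge v k%:R x) -> x = 0.
Proof.
move=> h; apply/eqP/negPn/negP => x0.
have := h (Num.truncn `|v x|).+1; rewrite val_geE // leNgt => /negP; apply.
apply: le_lt_trans (ler_norm _) _.
by have /andP[] := truncn_itv (normr_ge0 (v x)).
Qed.

End ValuationTheory.

Lemma rat_lt_nat (C : rat) : exists n : nat, C < n%:R.
Proof.
exists (Num.truncn `|C|).+1; apply: le_lt_trans (ler_norm _) _.
by have /andP[] := truncn_itv (normr_ge0 C).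
Qed.

Lemma choice_fun (A B : Type) (P : A -> B -> Prop) :
  (forall a, exists b, P a b) -> exists f, forall a, P a (f a).
Proof.
move=> h; exists (fun a => proj1_sig (constructive_indefinite_description _ (h a))).
by move=> a; apply: proj2_sig (constructive_indefinite_description _ (h a)).
Qed.

Section NormEquivalence.

Variables (F E : fieldType) (i : {rmorphism F -> E}).
Variables (v : F -> rat) (w : E -> rat).
Hypotheses (hw : valuation w) (vC : val_complete v).
Hypothesis wi : forall a, a != 0 -> w (i a) = v a.

Lemma val_ge_morph k a : val_ge w k (i a) = val_ge v k a.
Proof.
have [->|a0] := eqVneq a 0; first by rewrite rmorph0 !val_ge0.
by rewrite !val_geE ?fmorph_eq0 // wi.
Qed.

Variable e : nat -> E.

Definition lcomb n (a : nat -> F) := \sum_(j < n) i (a j) * e j.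

Lemma lcombB n a b : lcomb n (fun j => a j - b j) = lcomb n a - lcomb n b.
Proof.
by rewrite /lcomb -sumrB; apply: eq_bigr => j _; rewrite rmorphB mulrBl.
Qed.

(* Completeness of the base makes the span of the first n vectors closed, so *)
(* the next one stays at a bounded distance from it.                         *)
Lemma norm_equivalence n :
  (forall a, lcomb n a = 0 -> forall j, (j < n)%N -> a j = 0) ->
  exists C : rat, forall a k, val_ge w k (lcomb n a) ->
    forall j, (j < n)%N -> val_ge v (k - C) (a j).
Proof.
elim: n => [|n IHn] indep; first by exists 0.
have /IHn[C hC] : forall a, lcomb n a = 0 -> forall j, (j < n)%N -> a j = 0.
  move=> a a0 j jn; pose b m := if (m < n)%N then a m else 0.
  have /(_ j (ltnW jn)) : forall j, (j < n.+1)%N -> b j = 0.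
    apply: indep; rewrite /lcomb big_ord_recr /= /b ltnn rmorph0 mul0r addr0.
    by rewrite -[RHS]a0 /lcomb; apply: eq_bigr => l _; rewrite ltn_ord.
  by rewrite /b jn.
have [D hD] : exists D : rat, forall a, e n + lcomb n a != 0 /\ w (e n + lcomb n a) < D.
  have nz a : e n + lcomb n a != 0.
    apply/eqP => h0; pose b m := if (m < n)%N then a m else 1.
    have /(_ n (ltnSn n)) : forall j, (j < n.+1)%N -> b j = 0.
      apply: indep; rewrite /lcomb big_ord_recr /= /b ltnn rmorph1 mul1r.
      by rewrite -[RHS]h0 addrC /lcomb; congr (_ + _); apply: eq_bigr => l _; rewrite ltn_ord.
    by rewrite /b ltnn => /eqP; rewrite oner_eq0.
  (* Otherwise the span comes arbitrarily close to [- e n]. By the induction hypothesis the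
     coefficients of the approximations are Cauchy, and their limits give a combination that [nz]
     forbids. *)
  apply: NNPP => /not_ex_all_not hD.
  have /choice_fun[a {}hD] (k : nat) : exists a, val_ge w k%:R (e n + lcomb n a).
    have /not_all_ex_not[a /not_and_or[]//] := hD k%:R.
    by move=> /negP; rewrite -leNgt => ?; exists a; rewrite val_geE.
  have /choice_fun[l hL] j : exists l : F, (j < n)%N ->
      forall k : nat, exists M : nat, forall m : nat, (M <= m)%N -> val_ge v k%:R (a m j - l).
    have [jn|] := boolP (j < n)%N; last by exists 0.
    have [k|l hl] := vC (u := fun m => a m j); last by exists l.
    have [M hM] := rat_lt_nat C; exists (k + M)%N => m1 m2 le1 le2.
    have : val_ge w (k + M)%:R (lcomb n (fun j => a m1 j - a m2 j)).
      have -> : lcomb n (fun j => a m1 j - a m2 j) =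
                (e n + lcomb n (a m1)) - (e n + lcomb n (a m2)).
        by rewrite lcombB; ring.
      by apply: val_geB => //; apply: (val_geW _ (hD _)); rewrite ler_nat.
    move=> /hC/(_ j jn); apply: val_geW; rewrite natrD; lra.
  have /eqP := nz l; apply; apply: (val_ge_all (v := w)) => k.
  have [B hB] : exists B : nat, forall j, (j < n)%N -> - B%:R <= w (e j).
    elim: (n) => [|m [B hB]]; first by exists 0.
    have [B' hB'] := rat_lt_nat (- w (e m)).
    exists (B + B')%N => j; rewrite ltnS leq_eqVlt natrD => /orP[/eqP->|/hB].
      have : 0 <= B%:R :> rat by []. lra.
    have : 0 <= B'%:R :> rat by []. lra.
  have [M hM] : exists M : nat, forall j, (j < n)%N -> forall m, (M <= m)%N ->
      val_ge v (k + B)%:R (a m j - l j).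
    elim: {-2}(n) (leqnn n) => [|m IHm] mn; first by exists 0.
    have [M1 h1] := IHm (ltnW mn); have [M2 h2] := hL m mn (k + B)%N.
    exists (M1 + M2)%N => j; rewrite ltnS leq_eqVlt => /orP[/eqP->|jm] m' hm'.
      by apply: h2; lia.
    by apply: h1 => //; lia.
  have -> : e n + lcomb n l = (e n + lcomb n (a (k + M)%N)) -
      lcomb n (fun j => a (k + M)%N j - l j) by rewrite lcombB; ring.
  apply: val_geB => //; first by apply: (val_geW _ (hD _)); rewrite ler_nat leq_addr.
  apply: val_ge_sum => // j _.
  rewrite mulrC; have -> : k%:R = - B%:R + (k + B)%:R :> rat by rewrite natrD; ring.
  by apply: val_geMl; rewrite ?hB // val_ge_morph hM // leq_addl.
have [B hB] := rat_lt_nat (- w (e n)).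
have [D' hD'] := rat_lt_nat D.
have [C' hC'] := rat_lt_nat C.
have B0 : 0 <= B%:R :> rat by [].
have D0 : 0 <= D'%:R :> rat by [].
have C0 : 0 <= C'%:R :> rat by [].
exists (D'%:R + B%:R + C'%:R) => a k hk.
(* Dividing the combination by [a n] gives a vector of the form [e n + lcomb n b], whose value is
   below [D]. *)
have han : val_ge v (k - D'%:R) (a n).
  have [->|an0] := eqVneq (a n) 0; first exact: val_ge0.
  pose b j := a j / a n.
  have [nz ltD] := hD b; rewrite val_geE //.
  have E1 : lcomb n.+1 a = i (a n) * (e n + lcomb n b).
    rewrite /lcomb big_ord_recr /= mulrDr addrC; congr (_ + _).
    rewrite mulr_sumr; apply: eq_bigr => j _.
    by rewrite mulrA -rmorphM /b mulrCA mulfV // mulr1.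
  move: hk; rewrite E1 val_geE ?mulf_neq0 ?fmorph_eq0 //.
  rewrite (valuationM hw) ?fmorph_eq0 // wi // => h; lra.
move=> j; rewrite ltnS leq_eqVlt => /orP[/eqP->|jn].
  by apply: val_geW han; lra.
have : val_ge w (k - D'%:R - B%:R) (lcomb n a).
  have -> : lcomb n a = lcomb n.+1 a - e n * i (a n).
    by rewrite /lcomb big_ord_recr /= [e n * _]mulrC addrK.
  apply: val_geB => //; first by apply: val_geW hk; lra.
  have -> : k - D'%:R - B%:R = - B%:R + (k - D'%:R) by ring.
  by apply: val_geMl; rewrite ?val_ge_morph //; lra.
by move=> /hC/(_ j jn); apply: val_geW; lra.
Qed.

End NormEquivalence.

(** * Uniqueness of extensions and finiteness of residue classes *)

Section ExtensionUnique.

Variables (F E : fieldType) (i : {rmorphism F -> E}).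
Variables (v : F -> rat) (n : nat) (e : nat -> E).

Lemma lcomb_val_ge (w : E -> rat) : valuation w ->
  (forall a, a != 0 -> w (i a) = v a) -> exists B : nat, forall a k,
  (forall j, (j < n)%N -> val_ge v k (a j)) -> val_ge w (k - B%:R) (lcomb i e n a).
Proof.
move=> hw wi; have [B hB] : exists B : nat, forall j, (j < n)%N -> - B%:R <= w (e j).
  elim: (n) => [|m [B hB]]; first by exists 0.
  have [B' hB'] := rat_lt_nat (- w (e m)).
  have B0 : 0 <= B%:R :> rat by [].
  have B0' : 0 <= B'%:R :> rat by [].
  exists (B + B')%N => j; rewrite ltnS leq_eqVlt natrD => /orP[/eqP->|/hB]; lra.
exists B => a k ha; apply: val_ge_sum => // j _.
by rewrite mulrC addrC; apply: val_geMl; rewrite ?hB // (val_ge_morph wi) ?ha.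
Qed.

Hypotheses (hv : valuation v) (vC : val_complete v).
Hypothesis e_free :
  forall a, lcomb i e n a = 0 -> forall j, (j < n)%N -> a j = 0.
Hypothesis e_span : forall x, exists a, x = lcomb i e n a.

(** Both valuations stay within a constant of the coordinatewise one, so [w y - w' y] is bounded
    above. On the powers of [x] this difference grows linearly, hence it cannot be positive. *)
Lemma val_extension_le (w w' : E -> rat) x :
  valuation w -> valuation w' ->
  (forall a, a != 0 -> w (i a) = v a) -> (forall a, a != 0 -> w' (i a) = v a) ->
  x != 0 -> w x <= w' x.
Proof.
move=> hw hw' wi wi' x0; rewrite leNgt; apply/negP => lt.
have [C hC] := norm_equivalence hw vC wi e_free.
have [B hB] := lcomb_val_ge hw' wi'.
have {hC hB} bnd y : y != 0 -> w y - C - B%:R <= w' y.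
  have [a ya] := e_span y => y0.
  rewrite -(val_geE w' _ y0) {2}ya; apply: hB => j jn.
  by apply: hC jn; rewrite -ya val_geE.
have [m hm] := rat_lt_nat ((C + B%:R) / (w x - w' x)).
have := bnd _ (expf_neq0 m x0); rewrite (valuationX hw) // (valuationX hw') //.
rewrite -(mulr_natr (w x)) -(mulr_natr (w' x)) => h.
have d0 : 0 < w x - w' x by rewrite subr_gt0.
by move: hm; rewrite ltr_pdivrMr // => hm; lra.
Qed.

Lemma val_extension_unique (w w' : E -> rat) x :
  valuation w -> valuation w' ->
  (forall a, a != 0 -> w (i a) = v a) -> (forall a, a != 0 -> w' (i a) = v a) ->
  x != 0 -> w x = w' x.
Proof.
by move=> hw hw' wi wi' x0; apply/eqP; rewrite eq_le !val_extension_le.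
Qed.

(** Finiteness of the residue rings. The map [cl] may be finer than congruence, and its values off
    the valuation ring do not matter. *)
Definition finite_classes (V : fieldType) (u : V -> rat) := forall M : nat,
  exists (T : finType) (cl : V -> T), forall x y,
    val_ge u 0 x -> val_ge u 0 y -> cl x = cl y -> val_ge u M%:R (x - y).

Lemma finite_classes_extension (w : E -> rat) (q : F) :
  valuation w -> (forall a, a != 0 -> w (i a) = v a) ->
  q != 0 -> v q = 1 -> finite_classes v -> finite_classes w.
Proof.
move=> hw wi q0 vq fcv M.
have [C0 hC0] := norm_equivalence hw vC wi e_free.
have [C ltC] := rat_lt_nat C0.
have [B hB] := lcomb_val_ge hw wi.
(* Scaling by [q ^+ C] makes the coordinates of integral elements integral; the precision makes up
   for this factor and for the loss [B] in recombining coordinates. *)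
have [T [cl hcl]] := fcv (M + B + C)%N.
have [a ha] := choice_fun e_span.
exists {ffun 'I_n -> T}, (fun x => [ffun j : 'I_n => cl (q ^+ C * a x j)]).
have int x j : (j < n)%N -> val_ge w 0 x -> val_ge v 0 (q ^+ C * a x j).
  move=> jn; rewrite {1}(ha x) => /hC0/(_ j jn) h.
  have -> : 0 = C%:R + (- C%:R) :> rat by rewrite subrr.
  by apply: val_geMl => //; [rewrite (valuationX hv) // vq | apply: val_geW h; lra].
move=> x y wx wy /ffunP eqcl.
have -> : x - y = lcomb i e n (fun j => a x j - a y j) by rewrite lcombB -!ha.
have -> : M%:R = (M + B)%:R - B%:R :> rat by rewrite natrD addrK.
apply: hB => j jn; have := eqcl (Ordinal jn); rewrite !ffunE /= => /hcl.
move=> /(_ (int _ _ jn wx) (int _ _ jn wy)); rewrite -mulrBr val_ge_Vl ?expf_neq0 //.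
by rewrite (valuationX hv) // vq natrD addrK.
Qed.

End ExtensionUnique.

(** * Residues modulo powers of p in Q_p *)

Section Qp.

Variables (p : nat) (p_prime : prime p) (F : fieldType) (v : F -> rat).
Hypothesis hF : is_Qp p v.

Let hv := Qp_valuation hF.

Lemma Qp_nat_neq0 n : (0 < n)%N -> n%:R != 0 :> F.
Proof. by have /pcharf0P-> := Qp_pchar0 hF; rewrite -lt0n. Qed.

Lemma Qp_val_nat n : (0 < n)%N -> v n%:R = (logn p n)%:R.
Proof.
move=> n0; have := @Qp_padic _ _ _ hF n%:R; rewrite ratr_nat => ->.
  by rewrite /padic_val -[n%:R]/(n%:~R) numq_int denq_int logn1 subr0.
by rewrite pnatr_eq0 -lt0n.
Qed.

Lemma Qp_val_int_ge0 (z : int) : val_ge v 0 z%:~R.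
Proof.
by case: z => n; rewrite ?NegzE ?mulrNz ?val_geN // -pmulrn val_ge_nat.
Qed.

Lemma Qp_int_neq0 (z : int) : z != 0 -> z%:~R != 0 :> F.
Proof.
case: z => n hn; last by rewrite NegzE mulrNz oppr_eq0 -pmulrn Qp_nat_neq0.
by rewrite -pmulrn Qp_nat_neq0 // lt0n.
Qed.

(** A rational number close to [x] is integral, so p does not divide its denominator, which a Bezout
    relation inverts modulo p^M. *)
Lemma Qp_residue (x : F) (M : nat) : val_ge v 0 x ->
  exists r : 'I_(p ^ M), val_ge v M%:R (x - r%:R).
Proof.
move=> vx; have [q hq] := Qp_dense hF x M.
have vq : val_ge v 0 (ratr q).
  have -> : ratr q = x - (x - ratr q) by ring.
  by apply: val_geB => //; apply: val_geW hq.
have dF0 : (denq q)%:~R != 0 :> F by rewrite Qp_int_neq0 ?denq_neq0.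
have pnd : ~~ (p %| `|denq q|)%N.
  apply/negP => pd.
  have q0 : q != 0.
    apply: contraTneq pd => ->; rewrite -(mulr0z 1) denq_int dvdn1.
    by rewrite neq_ltn prime_gt1 ?orbT.
  move: vq; rewrite val_geE ?(Qp_padic hF) //; last first.
    by rewrite /ratr mulf_neq0 ?invr_eq0 ?Qp_int_neq0 ?numq_eq0.
  rewrite /padic_val subr_ge0 ler_nat leqNgt => /negP; apply.
  have: coprime p `|numq q|.
    by apply: coprime_dvdl pd _; rewrite coprime_sym coprime_num_den.
  rewrite prime_coprime // => pn.
  rewrite (@lognE p `|numq q|) (negPf pn) !andbF.
  by rewrite logn_gt0 mem_primes p_prime pd absz_gt0 denq_neq0.
have pd : coprimez (denq q) (p ^ M)%N.
  rewrite /coprimez /gcdz eqz_nat -/(coprime _ _) /= coprime_sym coprimeXl //.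
  by rewrite prime_coprime.
have vd : v (denq q)%:~R = 0.
  rewrite -absz_denq -pmulrn Qp_val_nat ?absz_gt0 ?denq_neq0 //.
  by rewrite lognE (negPf pnd) !andbF.
have [[a b] /= ab] := coprimezP _ _ pd.
pose r := ((numq q * a) %% (p ^ M)%N)%Z.
have pM0 : ((p ^ M)%N%:Z != 0) by rewrite eqz_nat -lt0n expn_gt0 prime_gt0.
have r0 : 0 <= r by rewrite modz_ge0.
have rlt : (`|r| < p ^ M)%N by rewrite -ltz_nat gez0_abs // ltz_pmod // ltz_nat expn_gt0 prime_gt0.
exists (Ordinal rlt) => /=.
have -> : x - `|r|%:R = (x - ratr q) + (ratr q - `|r|%:R) by ring.
apply: val_geD => //.
have -> : `|r|%:R = r%:~R :> F by rewrite pmulrn gez0_abs.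
pose c := numq q * b + ((numq q * a) %/ (p ^ M)%N)%Z * denq q.
have key : numq q - r * denq q = c * (p ^ M)%N.
  have er : r = numq q * a - ((numq q * a) %/ (p ^ M)%N)%Z * (p ^ M)%N.
    by rewrite {1}(divz_eq (numq q * a) (p ^ M)%N) addrC addKr.
  rewrite er /c -{1}[numq q]mulr1 -ab; ring.
rewrite -(mulfK dF0 r%:~R) /ratr -mulrBl -intrM -intrB key mulrC.
rewrite val_ge_Vl ?invr_eq0 // (valuationV hv) //.
rewrite vd oppr0 subr0 rmorphM /= -pmulrn -[M%:R]add0r.
apply: val_geM => //; first exact: Qp_val_int_ge0.
by rewrite val_geE ?Qp_nat_neq0 ?expn_gt0 ?prime_gt0 // Qp_val_nat ?expn_gt0 ?prime_gt0 // pfactorK.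
Qed.

Lemma Qp_finite_classes : finite_classes v.
Proof.
move=> M.
have /choice_fun[cl hcl] x : exists r : 'I_(p ^ M), val_ge v 0 x -> val_ge v M%:R (x - r%:R).
  have [vx|nvx] := boolP (val_ge v 0 x).
    by have [r] := Qp_residue M vx; exists r.
  have pM : (0 < p ^ M)%N by rewrite expn_gt0 prime_gt0.
  by exists (Ordinal pM).
exists 'I_(p ^ M), cl => x y vx vy eqcl.
have -> : x - y = (x - (cl x)%:R) - (y - (cl y)%:R) by rewrite eqcl; ring.
by apply: val_geB; rewrite ?hcl.
Qed.

End Qp.

Lemma basis_over_base (F : fieldType) (K : fieldExtType F) (E : fieldExtType K) :
  exists n (e : nat -> E),
    (forall a, lcomb (in_alg E \o in_alg K) e n a = 0 ->
       forall j, (j < n)%N -> a j = 0) /\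
    (forall x, exists a, x = lcomb (in_alg E \o in_alg K) e n a).
Proof.
pose B := vbasis {:baseFieldType E}; pose n := \dim {:baseFieldType E}.
pose e j : baseFieldType E := nth 0 B j.
have scE (a : nat -> F) : lcomb (in_alg E \o in_alg K) e n a =
    \sum_(j < n) a j *: e j :> baseFieldType E.
  by apply: eq_bigr => j _; rewrite baseField_scaleE /= mulr_algl.
exists n, e; split=> [a|x].
  rewrite scE => a0 j jn.
  have /freeP fr := basis_free (vbasisP {:baseFieldType E}).
  exact: (fr (fun j => a j) a0 (Ordinal jn)).
have := coord_vbasis (memvf (x : baseFieldType E)) => xE.
exists (fun j => oapp (coord B ^~ x) 0 (insub j)).
rewrite scE {1}xE; apply: eq_bigr => j _.
by rewrite valK.
Qed.

(** * Commutative group algebras *)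

(* The phantom argument gC lets the commutative ring structure be inferred   *)
(* from the type.                                                             *)
Definition cgalg (gT : finGroupType) (R : comNzRingType)
  (gC : commutative (@mulg gT)) : Type := {ffun gT -> R}.

Section GroupAlgebra.

Variables (gT : finGroupType) (R : comNzRingType) (gC : commutative (@mulg gT)).
Local Notation A := (cgalg R gC).
Implicit Types (a b c : A) (n m k : gT).

HB.instance Definition _ := GRing.Zmodule.copy A {ffun gT -> R}.

Definition gcoef (c : A) n : R := (c : {ffun gT -> R}) n.
Definition mk_galg (f : gT -> R) : A := [ffun n => f n].

Lemma gcoef_mk f n : gcoef (mk_galg f) n = f n.
Proof. by rewrite /gcoef ffunE. Qed.

Lemma gcoefP a b : gcoef a =1 gcoef b -> a = b.
Proof. by move=> h; apply/ffunP. Qed.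

Lemma gcoefD a b n : gcoef (a + b) n = gcoef a n + gcoef b n.
Proof. by rewrite /gcoef ffunE. Qed.

Lemma gcoef0 n : gcoef 0 n = 0.
Proof. by rewrite /gcoef ffunE. Qed.

Lemma gcoefN a n : gcoef (- a) n = - gcoef a n.
Proof. by rewrite /gcoef ffunE. Qed.

Lemma gcoef_sum (I : Type) (r : seq I) (P : pred I) (f : I -> A) n :
  gcoef (\sum_(i <- r | P i) f i) n = \sum_(i <- r | P i) gcoef (f i) n.
Proof.
elim: r => [|i r IHr]; first by rewrite !big_nil gcoef0.
by rewrite !big_cons; case: (P i); rewrite ?gcoefD IHr.
Qed.

Definition gmul a b : A := mk_galg (fun k => \sum_m gcoef a m * gcoef b (m^-1 * k)%g).
Definition mono (x : R) n : A := mk_galg (fun k => x *+ (k == n)).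

Lemma gcoef_mono x n k : gcoef (mono x n) k = x *+ (k == n).
Proof. exact: gcoef_mk. Qed.

Lemma mono_sum a : a = \sum_n mono (gcoef a n) n.
Proof.
apply: gcoefP => k; rewrite gcoef_sum (bigD1 k) //= gcoef_mono eqxx big1 ?addr0 // => n.
by rewrite gcoef_mono eq_sym => /negPf->.
Qed.

Lemma gmulC : commutative gmul.
Proof.
move=> a b; apply: gcoefP => k; rewrite !gcoef_mk.
rewrite (reindex_inj (inj_comp (mulgI k) invg_inj)) /=.
by apply: eq_bigr => m _; rewrite mulrC invMg invgK mulgKV [(k * _)%g]gC.
Qed.

Lemma gmulDl : left_distributive gmul +%R.
Proof.
move=> a b c; apply: gcoefP => k; rewrite gcoefD !gcoef_mk -big_split /=.
by apply: eq_bigr => m _; rewrite gcoefD mulrDl.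
Qed.

Lemma gmulA : associative gmul.
Proof.
move=> a b c; apply: gcoefP => k; rewrite !gcoef_mk.
under eq_bigr => m _ do rewrite gcoef_mk mulr_sumr.
under [RHS]eq_bigr => m _ do rewrite gcoef_mk mulr_suml.
rewrite [RHS]exchange_big /=; apply: eq_bigr => m _.
rewrite [RHS](reindex_inj (mulgI m)) /=; apply: eq_bigr => l _.
by rewrite mulrA mulKg invMg mulgA.
Qed.

Lemma gmul1 : left_id (mono 1 1%g) gmul.
Proof.
move=> a; apply: gcoefP => k; rewrite gcoef_mk (bigD1 1%g) //= gcoef_mono eqxx.
rewrite mul1r invg1 mul1g big1 ?addr0 // => m /negPf m1.
by rewrite gcoef_mono m1 mul0r.
Qed.

Lemma gone_neq0 : mono 1 1%g != 0.
Proof.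
apply/eqP => /(congr1 (gcoef^~ 1%g)) /eqP; rewrite gcoef_mono gcoef0 eqxx.
by rewrite oner_eq0.
Qed.

HB.instance Definition _ :=
  GRing.Zmodule_isComNzRing.Build A gmulA gmulC gmul1 gmulDl gone_neq0.

Lemma gcoefM a b k : gcoef (a * b) k = \sum_m gcoef a m * gcoef b (m^-1 * k)%g.
Proof. exact: gcoef_mk. Qed.

Lemma mono1 : mono 1 1%g = 1. Proof. by []. Qed.

Lemma monoM x y n m : mono x n * mono y m = mono (x * y) (n * m)%g.
Proof.
apply: gcoefP => k; rewrite gcoefM (bigD1 n) //= big1 ?addr0 => [|l /negPf nl].
  by rewrite !gcoef_mono eqxx (can2_eq (mulKVg n) (mulKg n)) mulrnAr.
by rewrite gcoef_mono nl mul0r.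
Qed.

Lemma monoX x n (m : nat) : mono x n ^+ m = mono (x ^+ m) (n ^+ m)%g.
Proof.
elim: m => [|m IHm]; first by rewrite !expr0 expg0.
by rewrite !exprS IHm monoM expgS.
Qed.

Lemma gcoef_mono1M x a k : gcoef (mono x 1%g * a) k = x * gcoef a k.
Proof.
rewrite gcoefM (bigD1 1%g) //= big1 ?addr0 => [|l /negPf nl].
  by rewrite gcoef_mono eqxx invg1 mul1g.
by rewrite gcoef_mono nl mul0r.
Qed.

Lemma gcoefMn a (m : nat) k : gcoef (a *+ m) k = gcoef a k *+ m.
Proof.
by elim: m => [|m IHm]; rewrite ?mulr0n ?gcoef0 // !mulrS gcoefD IHm.
Qed.

End GroupAlgebra.

(** * The p-th power map modulo p *)

Section FrobeniusModp.

Variables (A : comNzRingType) (P : A -> Prop) (p : nat) (p_prime : prime p).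
Hypotheses (P0 : P 0) (P1 : P 1).
Hypotheses (PD : forall x y, P x -> P y -> P (x + y)).
Hypotheses (PM : forall x y, P x -> P y -> P (x * y)).

(** The inner binomial coefficients are divisible by p. The predicate [P] stands for a subring such
    as the integral elements, so that the correction is p times an element of it. *)
Lemma exprD_modp x y : P x -> P y ->
  exists2 z, P z & (x + y) ^+ p = x ^+ p + y ^+ p + z *+ p.
Proof.
move=> Px Py.
have PX x' m : P x' -> P (x' ^+ m).
  by move=> Px'; elim: m => [|m IHm]; rewrite ?expr0 // exprS; apply: PM.
have PMn x' m : P x' -> P (x' *+ m).
  by move=> Px'; elim: m => [|m IHm]; rewrite ?mulr0n // mulrS; apply: PD.
case: p p_prime => [|[|q]] // pr; set r := q.+2 in pr *.
exists (\sum_(i < q.+1) (x ^+ (r - i.+1) * y ^+ i.+1) *+ ('C(r, i.+1) %/ r)).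
  elim/big_rec: _ => // i s _ Ps; apply: PD => //; apply: PMn; apply: PM; exact: PX.
rewrite exprDn big_ord_recl big_ord_recr /= subn0 expr0 mulr1 bin0 mulr1n.
rewrite /bump /= add1n subnn expr0 mul1r binn mulr1n -addrA; congr (_ + _).
rewrite addrC; congr (_ + _); rewrite -sumrMnl; apply: eq_bigr => i _.
rewrite /bump /= add1n -mulrnA divnK // prime_dvd_bin //= ltnS.
by rewrite [(_ < _)%N]ltn_ord.
Qed.

Lemma expr_sum_modp (I : Type) (r : seq I) (f : I -> A) : (forall i, P (f i)) ->
  exists2 z, P z & (\sum_(i <- r) f i) ^+ p = \sum_(i <- r) f i ^+ p + z *+ p.
Proof.
move=> Pf; elim: r => [|i r [z Pz IHr]].
  exists 0 => //; rewrite !big_nil mul0rn addr0 expr0n.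
  by case: p p_prime.
have Ps : P (\sum_(i <- r) f i) by elim/big_rec: _ => // j s _; apply: PD.
have [z' Pz' E] := exprD_modp (Pf i) Ps.
exists (z + z'); first exact: PD.
by rewrite !big_cons E IHr mulrnDl !addrA.
Qed.

End FrobeniusModp.

(** * The Gauss valuation and its power-multiplicativity *)

Section GaussValuation.

Variables (gT : finGroupType) (E : fieldType) (gC : commutative (@mulg gT)).
Local Notation A := (cgalg E gC).
Variables (v : E -> rat) (hv : valuation v).

Definition cge (k : rat) (c : A) := forall n, val_ge v k (gcoef c n).

Lemma cge0 k : cge k 0.
Proof. by move=> n; rewrite gcoef0 val_ge0. Qed.

Lemma cge1 : cge 0 1.
Proof.
move=> n; rewrite -mono1 gcoef_mono; case: (n == 1%g); last exact: val_ge0.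
exact: (val_ge_nat hv 1).
Qed.

Lemma cgeD k a b : cge k a -> cge k b -> cge k (a + b).
Proof. by move=> ha hb n; rewrite gcoefD val_geD. Qed.

Lemma cgeN k a : cge k a -> cge k (- a).
Proof. by move=> ha n; rewrite gcoefN val_geN. Qed.

Lemma cgeB k a b : cge k a -> cge k b -> cge k (a - b).
Proof. by move=> ha hb; apply: cgeD => //; apply: cgeN. Qed.

Lemma cgeM k l a b : cge k a -> cge l b -> cge (k + l) (a * b).
Proof.
by move=> ha hb n; rewrite gcoefM; apply: val_ge_sum => // m _; apply: val_geM.
Qed.

Lemma cge0M k a b : cge 0 a -> cge k b -> cge k (a * b).
Proof. by rewrite -{2}[k]add0r; apply: cgeM. Qed.

Lemma cgeW k l a : l <= k -> cge k a -> cge l a.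
Proof. by move=> lk h n; apply: val_geW (h n). Qed.

Lemma cgeX k a m : cge k a -> cge (k *+ m) (a ^+ m).
Proof.
move=> ha; elim: m => [|m IHm]; first by rewrite expr0 mulr0n; apply: cge1.
by rewrite exprS mulrS; apply: cgeM.
Qed.

Lemma cge_mono k x n : val_ge v k x -> cge k (mono gC x n).
Proof. by move=> h m; rewrite gcoef_mono; case: eqP; rewrite ?val_ge0. Qed.

Lemma cge_exact c : c != 0 -> exists2 n, gcoef c n != 0 & cge (v (gcoef c n)) c.
Proof.
move=> c0; have /existsP[n0 hn0] : [exists n, gcoef c n != 0].
  apply: contraNT c0 => /existsPn h; apply/eqP/gcoefP => n.
  by rewrite gcoef0; apply/eqP; rewrite -[_ == _]negbK h.
case: (@Order.TotalTheory.arg_minP _ _ _ n0 (fun n => gcoef c n != 0)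
  (fun n => v (gcoef c n)) hn0) => n hn hmin.
exists n => // m; have [->|m0] := eqVneq (gcoef c m) 0; first exact: val_ge0.
by rewrite val_geE // hmin.
Qed.

Lemma cge_bounded c : exists C : rat, cge C c.
Proof.
have [->|/cge_exact[n _ h]] := eqVneq c 0; first by exists 0; apply: cge0.
by exists (v (gcoef c n)).
Qed.

Variables (p : nat) (p_prime : prime p).
Hypotheses (p_neq0 : p%:R != 0 :> E) (vp : v p%:R = 1) (pG : coprime p #|gT|).

Lemma expg_p_inj : injective (fun n : gT => (n ^+ p)%g).
Proof.
move=> n m /= /(congr1 (fun x => x ^+ expg_invn [set: gT] p)%g).
have cop : coprime #|[set: gT]| p by rewrite cardsT coprime_sym.
by rewrite !expgK ?inE.
Qed.

(** Divide [c] by a coefficient of least valuation, say at [n]. The quotient [u] is integral with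
    coefficient 1 at [n]; since p-th powers are injective on the group, the Frobenius congruence
    gives [u ^+ p] the coefficient 1 plus a multiple of p at [n ^+ p], which has valuation 0. *)
Lemma cge_expp k c : cge (k *+ p) (c ^+ p) -> cge k c.
Proof.
have [->|/cge_exact[n c0 hc]] := eqVneq c 0; first by move=> _; apply: cge0.
suff /(_ (n ^+ p)%g) h : forall m, val_ge v (k *+ p) (gcoef (c ^+ p) m) ->
    m = (n ^+ p)%g -> k <= v (gcoef c n).
  by move=> /(_ (n ^+ p)%g)/h/(_ erefl) le; apply: cgeW hc.
move=> m hm mE; set x := gcoef c n in c0 hc *.
pose u : A := mono gC x^-1 1%g * c.
have cE : c = mono gC x 1%g * u by rewrite /u mulrA monoM mulfV // mulg1 mono1 mul1r.
have u0 : cge 0 u.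
  move=> l; rewrite gcoef_mono1M val_ge_Vl ?invr_eq0 // valuationV // opprK add0r; exact: hc.
have [z z0 uE] := @expr_sum_modp _ (cge 0) p p_prime (cge0 0) cge1
  (@cgeD 0) (@cge0M 0) _ (index_enum gT) (fun l => mono gC (gcoef u l) l)
  (fun l => cge_mono l (u0 l)).
rewrite -mono_sum in uE.
have unE : gcoef (u ^+ p) (n ^+ p)%g = 1 + gcoef z (n ^+ p)%g *+ p.
  rewrite uE gcoefD gcoefMn gcoef_sum (bigD1 n) //= monoX gcoef_mono eqxx mulr1n.
  rewrite gcoef_mono1M mulVf // expr1n big1 ?addr0 // => l nl.
  rewrite monoX gcoef_mono eq_sym; case: eqP => // /expg_p_inj ln.
  by rewrite ln eqxx in nl.
have small : val_ge v 1 (gcoef z (n ^+ p)%g *+ p).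
  rewrite -mulr_natl -[1]addr0; apply: val_geM => //.
  by rewrite val_geE // vp.
move: hm; rewrite mE cE exprMn monoX expg1n gcoef_mono1M val_ge_Vl ?expf_neq0 //.
rewrite (valuationX hv) // unE => hm.
rewrite leNgt; apply/negP => lt.
have p0 : 0 < p%:R :> rat by rewrite ltr0n prime_gt0.
have pos : 0 < k *+ p - v x *+ p by rewrite -mulrnBl pmulrn_lgt0 ?prime_gt0 // subr_gt0.
pose d := Num.min (k *+ p - v x *+ p) 1.
have d0 : 0 < d by rewrite lt_min pos.
have : val_ge v d 1.
  rewrite -[1](addrK (gcoef z (n ^+ p)%g *+ p)); apply: val_geB => //.
    by apply: val_geW hm; rewrite ge_min lexx.
  by apply: val_geW small; rewrite ge_min lexx orbT.
by rewrite val_geE ?oner_neq0 // valuation1 // leNgt d0.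
Qed.

Lemma cge_exppX s k c : cge (k *+ (p ^ s)%N) (c ^+ (p ^ s)%N) -> cge k c.
Proof.
elim: s k c => [|s IHs] k c; first by rewrite expn0 mulr1n expr1.
rewrite expnSr exprM mulrnA => h; apply: IHs; exact: cge_expp h.
Qed.

(** If the Gauss valuation x of [c] were less than [k], then splitting c^(p^m) into c^m and c^(p^m -
    m) would bound its Gauss valuation below by km + x(p^m - m), which exceeds x p^m; this
    contradicts [cge_exppX]. *)
Lemma cge_root k c m : (0 < m)%N -> cge (k *+ m) (c ^+ m) -> cge k c.
Proof.
move=> m0; have [->|/cge_exact[n c0 hc]] := eqVneq c 0; first by move=> _; apply: cge0.
move=> hm; set x := v (gcoef c n) in hc.
have [le|lt] := leP k x; first exact: cgeW hc.
have mp : (m <= p ^ m)%N by rewrite ltnW // ltn_expl // prime_gt1.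
have p0 : (0 < p ^ m)%N by rewrite expn_gt0 prime_gt0.
have q0 : 0 < (p ^ m)%N%:R :> rat by rewrite ltr0n.
have mq0 : 0 < m%:R :> rat by rewrite ltr0n.
have h : cge ((x + (k - x) * m%:R / (p ^ m)%N%:R) *+ (p ^ m)) (c ^+ (p ^ m)).
  have -> : (x + (k - x) * m%:R / (p ^ m)%N%:R) *+ (p ^ m) =
            k *+ m + x *+ (p ^ m - m).
    rewrite -(mulr_natr (x + _)) mulrDl divfK ?gt_eqF //.
    rewrite -(mulr_natr k m) -(mulr_natr x (p ^ m - m)) natrB //; ring.
  by rewrite -{2}(subnKC mp) exprD; apply: cgeM => //; apply: cgeX.
have := cge_exppX h n; rewrite val_geE // -/x gerDl leNgt.
by rewrite divr_gt0 // mulr_gt0 // subr_gt0.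
Qed.

End GaussValuation.

(** * Units of the group algebra *)

Section Units.

Variables (gT : finGroupType) (E : fieldType) (gC : commutative (@mulg gT)).
Local Notation A := (cgalg E gC).

Definition mul_mx (c : A) : 'M[E]_#|gT| :=
  \matrix_(i, j) gcoef c ((enum_val i)^-1 * enum_val j)%g.

Definition row_galg (r : 'rV[E]_#|gT|) : A := mk_galg gC (fun n => r 0 (enum_rank n)).

Lemma row_galgM (r : 'rV[E]_#|gT|) c : row_galg (r *m mul_mx c) = row_galg r * c.
Proof.
apply: gcoefP => k; rewrite gcoef_mk gcoefM mxE (reindex enum_rank) /=; last first.
  by apply: onW_bij; apply: enum_rank_bij.
by apply: eq_bigr => m _; rewrite gcoef_mk mxE !enum_rankK.
Qed.

Lemma row_galg_surj c : exists r, c = row_galg r.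
Proof.
exists (\row_j gcoef c (enum_val j)); apply: gcoefP => k.
by rewrite gcoef_mk mxE enum_rankK.
Qed.

Lemma mul_mxD (a b : A) : mul_mx (a + b) = mul_mx a + mul_mx b.
Proof. by apply/matrixP => i j; rewrite !mxE gcoefD. Qed.

Lemma mul_mx_mono1M x a : mul_mx (mono gC x 1%g * a) = x *: mul_mx a.
Proof. by apply/matrixP => i j; rewrite !mxE gcoef_mono1M. Qed.

Lemma mul_mx1 : mul_mx 1 = 1%:M.
Proof.
apply/matrixP => i j; rewrite !mxE -mono1 gcoef_mono -eq_mulVg1.
by rewrite (inj_eq enum_val_inj).
Qed.

Lemma galg_unit (c : A) : \det (mul_mx c) != 0 -> exists d : A, d * c = 1.
Proof.
rewrite -unitfE -unitmxE => u; have [r rE] := row_galg_surj 1.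
by exists (row_galg (r *m invmx (mul_mx c))); rewrite -row_galgM mulmxKV.
Qed.

Lemma galg_regular_unit (c : A) : (forall d : A, d * c = 0 -> d = 0) -> exists d : A, d * c = 1.
Proof.
move=> reg; apply: galg_unit; apply/det0P => -[r r0 rc0].
case/eqP: r0; apply/rowP => j; rewrite !mxE.
have /reg : row_galg r * c = 0.
  by rewrite -row_galgM rc0; apply: gcoefP => n; rewrite gcoef_mk gcoef0 mxE.
by move=> /(congr1 (fun d : A => gcoef d (enum_val j))); rewrite gcoef_mk gcoef0 enum_valK.
Qed.

Variables (v : E -> rat) (hv : valuation v).

(** Multiplication by [d] raises the Gauss valuation by at least [k]. Hence c = -cd forces c = 0, so
    [1 + d] is not a zero divisor, and its inverse f = 1 - fd cannot have negative Gauss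
    valuation. *)
Lemma cge_unit1 k d : 0 < k -> cge v k d ->
  exists2 f : A, f * (1 + d) = 1 & cge v 0 f.
Proof.
move=> k0 hd; have [f hf] : exists f, f * (1 + d) = 1.
  apply: galg_regular_unit => c; rewrite mulrDr mulr1 => /eqP.
  rewrite addr_eq0 => /eqP cE; apply/eqP/negPn/negP => c0.
  have [n cn0 hc] := cge_exact v c0.
  have := cgeN hv (cgeM hv hc hd) n; rewrite -cE val_geE // => le; lra.
exists f => //; have [->|f0] := eqVneq f 0; first exact: cge0.
have [n fn0 hc] := cge_exact v f0.
have fE : f = 1 - f * d by rewrite -hf; ring.
have [le|lt] := leP 0 (v (gcoef f n)); first exact: cgeW hc.
pose m := Num.min 0 (v (gcoef f n) + k).
have : cge v m f.
  rewrite fE; apply: cgeB => //.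
    by apply: cgeW (cge1 _ hv); rewrite ge_min lexx.
  by apply: cgeW (cgeM hv hc hd); rewrite ge_min lexx orbT.
move=> /(_ n); rewrite val_geE // /m ge_min => /orP[]; lra.
Qed.

End Units.

(** * Free lattices in a group algebra *)

Lemma rat_neg_multiple (q : rat) : q < 0 ->
  exists m a : nat, (0 < m)%N /\ q *+ m = - a%:R.
Proof.
move=> q0; exists `|denq q|%N, `|numq q|%N; split.
  by rewrite absz_gt0 denq_neq0.
have -> : `|numq q|%:R = - (numq q)%:~R :> rat.
  by rewrite pmulrn ltz0_abs ?mulrNz // numq_lt0.
rewrite opprK -mulr_natr pmulrn absz_denq -{1}(divq_num_den q) divfK //.
by rewrite intr_eq0 denq_neq0.
Qed.

Section FreeLattice.

Variables (gT : finGroupType) (E : fieldType) (gC : commutative (@mulg gT)).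
Local Notation A := (cgalg E gC).
Variables (v : E -> rat) (hv : valuation v).
Variables (p : nat) (p_prime : prime p).
Hypotheses (p_neq0 : p%:R != 0 :> E) (vp : v p%:R = 1) (pG : coprime p #|gT|).
Hypothesis fcE : finite_classes v.

Local Notation P k := (mono gC ((p%:R : E) ^+ k) 1%g).

Lemma cgalg_finite_classes (M : nat) :
  exists (T : finType) (cl : A -> T), forall x y,
    cge v 0 x -> cge v 0 y -> cl x = cl y -> cge v M%:R (x - y).
Proof.
have [T [cl hcl]] := fcE M.
exists {ffun gT -> T}, (fun x => [ffun n => cl (gcoef x n)]) => x y x0 y0 /ffunP eqcl n.
by rewrite gcoefD gcoefN; apply: hcl; [apply: x0 | apply: y0 | have := eqcl n; rewrite !ffunE].
Qed.

Lemma pow_almost_idempotent (M : nat) (w : A) : cge v 0 w ->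
  exists2 j, (0 < j)%N & cge v M%:R (w ^+ j * (w ^+ j - 1)).
Proof.
move=> w0; have wX j : cge v 0 (w ^+ j) by rewrite -(mul0rn _ j); apply: cgeX.
have [T [cl hcl]] := cgalg_finite_classes M.
pose f (k : 'I_#|T|.+1) := cl (w ^+ k).
have [k [l [ltkl eqkl]]] : exists k l : nat, (k < l)%N /\ cl (w ^+ k) = cl (w ^+ l).
  have /injectivePn[k [l neq eqf]] : ~~ injectiveb f.
    apply/negP => /injectiveP inj_f.
    by have := leq_card _ inj_f; rewrite card_ord ltnn.
  have [lt|lt|/val_inj eq] := ltngtP k l; first by exists k, l.
    by exists l, k.
  by rewrite eq eqxx in neq.
pose t := (l - k)%N; have t0 : (0 < t)%N by rewrite subn_gt0.
have wk : cge v M%:R (w ^+ k * (w ^+ t - 1)).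
  rewrite mulrBr mulr1 -exprD subnKC 1?ltnW // -opprB.
  by apply: cgeN => //; apply: hcl.
(* A multiple of the period [t] that is at least the preperiod [k], so that w^j (w^j - 1) is a
   multiple of w^k (w^t - 1). *)
exists (t * k.+1)%N; first by rewrite muln_gt0 t0.
have kj : (k <= t * k.+1)%N by nia.
rewrite -{1}(subnK kj) exprD exprM subrX1.
set x := w ^+ k in wk *; set y := _ - 1 in wk *.
have -> : forall b c, b * x * (y * c) = (b * c) * (x * y) by move=> b c; ring.
apply: (cge0M hv) => //; apply: (cge0M hv) => //.
by elim/big_rec: _ => [|i z _ hz]; [apply: cge0 | apply: cgeD => //; rewrite -exprM].
Qed.

(** [H] stands for the Hopf algebra and [M] for the image of L in E[N]. By [Mdiv], an element of [M]
    that is a unit of E[N] generates [M] over [H]. *)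
Variables (H M : A -> Prop).
Hypotheses (H1 : H 1) (HD : forall a b, H a -> H b -> H (a + b)).
Hypotheses (HN : forall a, H a -> H (- a)) (HM : forall a b, H a -> H b -> H (a * b)).
Hypothesis HV : forall a b, H a -> b * a = 1 -> H b.
Hypotheses (MD : forall a b, M a -> M b -> M (a + b)).
Hypotheses (HMM : forall a b, H a -> M b -> M (a * b)).
Hypothesis Mdiv : forall u y d, M u -> M y -> d * u = 1 -> H (y * d).

Lemma subring_exp a k : H a -> H (a ^+ k).
Proof. by move=> h; elim: k => [|k IHk]; rewrite ?expr0 // exprS; apply: HM. Qed.

Lemma subring_pX k : H (P k).
Proof.
have <- : mono gC (p%:R : E) 1%g ^+ k = P k by rewrite monoX expg1n.
apply: subring_exp; have -> : mono gC (p%:R : E) 1%g = 1 *+ p :> A.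
  by apply: gcoefP => n; rewrite gcoefMn -mono1 !gcoef_mono -!mulrnA mulnC.
have : (0 < p)%N by rewrite prime_gt0.
by case: (p) => // m _; elim: m => [|m IHm]; rewrite ?mulr1n // mulrS; apply: HD.
Qed.

Lemma cgeP k : cge v k%:R (P k).
Proof.
by apply: cge_mono; rewrite val_geE ?expf_neq0 // (valuationX hv) // vp.
Qed.

(** With h = y/u of Gauss valuation q < 0, a power [e] of w = h^m p^a approximates the idempotent of
    the part where h is largest. The new generator is e y + (1 - e) u. *)
Lemma better_generator u d y : M u -> cge v 0 u -> d * u = 1 ->
  M y -> cge v 0 y -> ~ cge v 0 (y * d) ->
  exists u' d' a, [/\ M u', cge v 0 u' & d' * u' = 1] /\
    [/\ H a, cge v 0 a, u = a * u' & forall b, cge v 0 b -> u' <> b * u].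
Proof.
move=> Mu u0 du My y0; set h := y * d => nh.
have Hh : H h by apply: (Mdiv Mu).
have hu : h * u = y by rewrite /h -mulrA du mulr1.
have hn0 : h != 0 by apply/eqP => h0; apply: nh; rewrite h0; apply: cge0.
have [n hn hc] := cge_exact v hn0; set q := v _ in hc.
have q0 : q < 0 by rewrite ltNge; apply/negP => q0; apply: nh; apply: cgeW hc.
have [m [a [m0 qm]]] := rat_neg_multiple q0.
pose w := h ^+ m * P a.
have Hw : H w by apply: HM; [apply: subring_exp | apply: subring_pX].
have w0 : cge v 0 w.
  have -> : 0 = q *+ m + a%:R by rewrite qm addNr.
  by apply: (cgeM hv); [apply: (cgeX hv) | apply: cgeP].
have wX j : cge v 0 (w ^+ j) by rewrite -(mul0rn _ j); apply: (cgeX hv).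
(* The precision of the idempotent has to outweigh the denominator of [h]: the error [dl] is e(e -
   1) times a factor of Gauss valuation at least [q]. *)
have [B hB] := rat_lt_nat (- q).
have [j j0 hj] := pow_almost_idempotent B w0.
set e := w ^+ j in hj; have e0 : cge v 0 e by apply: wX.
have He : H e by apply: subring_exp.
pose h' := h ^+ m.-1 * P a * w ^+ j.-1.
have hh' : h * h' = e.
  have Ew : w = h * (h ^+ m.-1 * P a) by rewrite mulrA -exprS prednK.
  by rewrite /h' mulrA -Ew -exprS prednK.
have h'0 : cge v 0 h'.
  rewrite -[0]addr0; apply: (cgeM hv) => //; apply: cgeW (_ : cge v (q *+ m.-1 + a%:R) _).
    by have -> : a%:R = - (q *+ m) :> rat; [rewrite qm opprK | rewrite -(prednK m0) mulrS /=; lra].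
  by apply: (cgeM hv); [apply: (cgeX hv) | apply: cgeP].
have Hh' : H h' by apply: HM; [apply: HM; [apply: subring_exp | apply: subring_pX] | apply: subring_exp].
have c1 := cge1 gC hv.
have H1e : H (1 - e) by apply: HD => //; apply: HN.
have c1e : cge v 0 (1 - e) by apply: (cgeB hv).
(* [r] acts like [h] on the part cut out by [e] and like 1 on the complement; as h h' = e, the
   integral element [s] inverts it up to [dl]. *)
pose r := e * h + (1 - e); pose s := h' * e + (1 - e).
have Hr : H r by apply: HD => //; apply: HM.
have Hs : H s by apply: HD => //; apply: HM.
have s0 : cge v 0 s by apply: (cgeD hv) => //; apply: (cge0M hv).
pose dl := e * (e - 1) * (e + 1 + (1 - h) - h').
have rs : r * s = 1 + dl by rewrite /r /s /dl -hh'; ring.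
have cdl : cge v (B%:R + q) dl.
  apply: (cgeM hv) => //; apply: (cgeB hv); last by apply: cgeW h'0; apply: ltW.
  apply: (cgeD hv); first by apply: cgeW (ltW q0) _; apply: (cgeD hv).
  by apply: (cgeB hv) => //; apply: cgeW (ltW q0) _.
have [|f hf f0] := cge_unit1 hv _ cdl; first by lra.
have Hf : H f by apply: (HV _ hf); rewrite -rs; apply: HM.
have uE : s * f * (r * u) = u.
  by rewrite -[RHS]mul1r -hf -rs; ring.
exists (r * u), (d * (s * f)), (s * f); split; split.
- exact: HMM.
- have -> : r * u = e * y + (1 - e) * u by rewrite -hu /r; ring.
  by apply: (cgeD hv); apply: (cge0M hv).
- by rewrite -mulrA uE.
- exact: HM.
- exact: (cge0M hv).
- by rewrite uE.
move=> b b0 bE; have rb : r = b.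
  by rewrite -[r]mulr1 -du mulrCA bE mulrCA du mulr1.
(* If [r] were integral, so would be e h = p^(aj) h^(mj+1). Then [cge_root] bounds the Gauss
   valuation of [h] below by -aj/(mj+1), which is larger than q = -a/m. *)
have : cge v (- (a * j)%N%:R) (h ^+ (m * j).+1).
  have : cge v 0 (e * h).
    have -> : e * h = b - (1 - e) by rewrite -rb /r addrK.
    exact: (cgeB hv).
  have -> : e * h = mono gC ((p%:R : E) ^+ (a * j)) 1%g * h ^+ (m * j).+1.
    by rewrite /e /w exprMn monoX expg1n -!exprM exprS; ring.
  move=> hc' l; have := hc' l; rewrite gcoef_mono1M val_ge_Vl ?expf_neq0 //.
  by rewrite (valuationX hv) // vp sub0r.
have mj0 : 0 < (m * j).+1%:R :> rat by rewrite ltr0n.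
pose k : rat := - (a * j)%N%:R / (m * j).+1%:R.
have -> : - (a * j)%N%:R = k *+ (m * j).+1 by rewrite -(mulr_natr k) divfK ?gt_eqF.
move=> /(cge_root hv p_prime p_neq0 vp pG (ltn0Sn _)) /(_ n).
rewrite val_geE // -/q /k leNgt => /negP; apply.
rewrite ltr_pdivlMr // natrM -mulNr -qm -(mulr_natr q m) -natr1 natrM; lra.
Qed.

(** All lattices reached contain that of the first integral generator, hence every element of [M]
    divisible by p^C for a fixed [C]. They are therefore told apart by the finitely many classes
    modulo p^C, and each improvement meets a new class. *)
Theorem free_lattice u0 d0 : M u0 -> d0 * u0 = 1 ->
  exists u d, [/\ M u, cge v 0 u, d * u = 1 &
    forall y, M y -> cge v 0 y -> cge v 0 (y * d)].
Proof.
move=> Mu0; have [B0 hB0] := cge_bounded v u0.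
have [B hB] := rat_lt_nat (- B0) => du0.
have {Mu0} : exists u1 d1, [/\ M u1, cge v 0 u1 & d1 * u1 = 1].
  exists (P B * u0), (mono gC ((p%:R : E) ^- B) 1%g * d0); split.
  - by apply: HMM => //; apply: subring_pX.
  - apply: cgeW (cgeM hv (cgeP B) hB0); lra.
  - rewrite mulrACA du0 mulr1 monoM mulg1 mulVf ?expf_neq0 //.
move=> [{du0 hB0 hB}u0 [{}d0 [Mu0 cu0 du0]]].
have [C0 hC0] := cge_bounded v d0; have [C hC] := rat_lt_nat (- C0).
have PCV : mono gC ((p%:R : E) ^- C) 1%g * P C = 1.
  by rewrite monoM mulg1 mulVf ?expf_neq0.
have div0 z : M z -> cge v C%:R z -> exists b, [/\ H b, cge v 0 b & z = b * u0].
  move=> Mz cz; exists (z * d0); split; first exact: (Mdiv Mu0).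
    by apply: cgeW (cgeM hv cz hC0); lra.
  by rewrite -mulrA du0 mulr1.
have [T [cl hcl]] := cgalg_finite_classes C.
(* [U] is a set of classes known to be represented in the lattice of [u]; its growth measures
   progress. *)
pose inv (U : {set T}) u d := [/\ M u, cge v 0 u, d * u = 1,
  exists a, [/\ H a, cge v 0 a & u0 = a * u] &
  forall t, t \in U -> exists b, [/\ H b, cge v 0 b & cl (b * u) = t]].
have step U u d : inv U u d ->
    (forall y, M y -> cge v 0 y -> cge v 0 (y * d)) \/
    exists t u' d', t \notin U /\ inv (t |: U) u' d'.
  move=> [Mu cu du [a [Ha ca u0E]] hU].
  case: (classic (forall y, M y -> cge v 0 y -> cge v 0 (y * d))) => [h|nall]; [by left|].
  right; have [y ny] := not_all_ex_not _ _ nall.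
  have [My ny'] := imply_to_and _ _ ny.
  have [cy nc] := imply_to_and _ _ ny'.
  have [u' [d' [a' [[Mu' cu' du'] [Ha' ca' uE nE]]]]] :=
    better_generator Mu cu du My cy nc.
  exists (cl u'), u', d'; split.
    (* If u' and b u had the same class, their difference would be c u0 = c a u, making u' an
       integral multiple of u. *)
    apply/negP => /hU[b [Hb cb clE]].
    have cbu : cge v 0 (b * u) by apply: (cge0M hv).
    have [|c [Hc cc cE]] := div0 (u' - b * u) _ (hcl _ _ cu' cbu (esym clE)).
      by rewrite -mulNr; apply: MD => //; apply: HMM => //; apply: HN.
    apply: (nE (c * a + b)); first by apply: (cgeD hv) => //; apply: (cge0M hv).
    by rewrite mulrDl -mulrA -u0E -cE subrK.
  split=> //.
    exists (a * a'); split; [exact: HM | exact: (cge0M hv) | by rewrite -mulrA -uE].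
  move=> t; rewrite !inE => /orP[/eqP->|/hU[b [Hb cb clE]]].
    by exists 1; split; rewrite ?mul1r //; apply: (cge1 gC hv).
  by exists (b * a'); split; rewrite -?mulrA -?uE //; [apply: HM | apply: (cge0M hv)].
suff main k (U : {set T}) u d : (#|T| - #|U| <= k)%N -> inv U u d ->
    exists u d, [/\ M u, cge v 0 u, d * u = 1 &
      forall y, M y -> cge v 0 y -> cge v 0 (y * d)].
  apply: (main #|T| set0 u0 d0); first exact: leq_subr.
  split=> // [|t]; last by rewrite inE.
  by exists 1; split; rewrite ?mul1r //; apply: (cge1 gC hv).
elim: k U u d => [|k IHk] U u d cardU Iu;
  (have [all|[t [u' [d' [tU Iu']]]]] := step U u d Iu;
    first by case: Iu => Mu cu du _ _; exists u, d).
  have := max_card (mem (t |: U)); rewrite cardsU1 tU add1n; lia.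
apply: IHk Iu'; rewrite cardsU1 tU; lia.
Qed.

End FreeLattice.

(** * The Greither-Pareigis action *)

Section GaloisSide.

Variables (K : fieldType) (E : splittingFieldType K) (L : {subfield E}).
Local Notation X := (gpX L).
Local Notation G' := ('Gal({:E} / L))%g.
Hypothesis galE : galois 1 {:E}.
Implicit Types (g h : gal_of {:E}) (x : E).

Lemma gal_mul (g h : gal_of {:E}) x : (g * h)%g x = h (g x).
Proof. by rewrite galM ?memvf. Qed.

Lemma gpX_class (A : X) : exists g, A = gp_class L g.
Proof.
by case: A => A HA; case/rcosetsP: (HA) => g _ AE; exists g; apply: val_inj.
Qed.

Lemma galL_id h x : h \in G' -> x \in L -> h x = x.
Proof. exact: (fixed_gal (subvf L)). Qed.

Lemma coset_act_class g x : x \in L -> gp_coset_act (gp_class L g) x = g x.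
Proof.
move=> xL; rewrite /gp_coset_act /=; have := mem_repr_rcoset G' g.
by case/rcosetP=> h hG ->; rewrite gal_mul (galL_id hG).
Qed.

Lemma gp_lambdaE g A : gp_lambda L g A = gp_translate g A.
Proof. by rewrite permE. Qed.

Lemma gp_translate_class g h : gp_translate g (gp_class L h) = gp_class L (h * g)%g.
Proof. by apply: val_inj; rewrite /= rcosetM. Qed.

Lemma coset_act_lambda g (A : X) x : x \in L ->
  g (gp_coset_act A x) = gp_coset_act (gp_lambda L g A) x.
Proof.
move=> xL; have [h ->] := gpX_class A.
by rewrite gp_lambdaE gp_translate_class !coset_act_class // gal_mul.
Qed.

Lemma gp_lambdaM g h : gp_lambda L (g * h)%g = (gp_lambda L g * gp_lambda L h)%g.
Proof.
by apply/permP => A; rewrite permM !gp_lambdaE; apply: val_inj; rewrite /= rcosetM.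
Qed.

Lemma mem_fixed_galL x : (forall g, g \in G' -> g x = x) -> x \in L.
Proof.
move=> fx; have /galois_fixedField <- : galois L {:E}.
  by apply: galoisS galE; rewrite sub1v subvf.
by apply/fixedFieldP; [apply: memvf|].
Qed.

Lemma card_gpX : #|{: X}| = \dim L.
Proof.
have galL : galois L {:E} by apply: galoisS galE; rewrite sub1v subvf.
rewrite card_sig.
have -> : #|[pred A | A \in rcosets G' 'Gal({:E} / 1%AS)]| = #|'Gal({:E} / 1%AS) : G'|%g.
  by apply: eq_card => A; rewrite inE.
have sG : (G' \subset 'Gal({:E} / 1%AS))%g by apply: galS; apply: sub1v.
have := Lagrange sG; rewrite -(galois_dim galE) -(galois_dim galL) dimv1 divn1 => eqd.
have dL : (\dim L %| \dim {:E})%N by apply: field_dimS; apply: subvf.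
apply/eqP; rewrite -(@eqn_pmul2l (\dim_L {:E})) ?eqd ?divnK //.
by rewrite divn_gt0 ?adim_gt0 // dvdn_leq ?adim_gt0.
Qed.

(** By independence of automorphisms the matrix of the g(w_j) is invertible for suitable w_j; [B] is
    its inverse. *)
Lemma gal_dual_basis : exists n (w : 'I_n -> E) (B : gal_of {:E} -> 'I_n -> E),
  forall g g', \sum_j B g' j * g (w j) = (g == g')%:R.
Proof.
have [w _ [uM _ _]] := gal_matrix (setT : {set gal_of {:E}}).
set W := \matrix_(i, j) _ in uM.
have inT (g : gal_of {:E}) : g \in setT by rewrite inE.
pose r g := enum_rank_in (inT 1%g) g.
exists #|[set: gal_of {:E}]|, (tnth w), (fun g j => invmx W j (r g)) => g g'.
have /matrixP/(_ (r g) (r g')) := mulmxV uM; rewrite !mxE => eqM.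
transitivity ((r g == r g')%:R : E); last first.
  by congr (_%:R); rewrite (inj_in_eq (can_in_inj (enum_rankK_in (inT 1%g)))).
by rewrite -eqM; apply: eq_bigr => j _; rewrite mxE enum_rankK_in // mulrC.
Qed.

(** Take the traces from E to L of the previous family: summing the duality relation over Gal(E/L)
    leaves the delta function on cosets. *)
Lemma coset_dual_basis : exists n (w : 'I_n -> E) (B : X -> 'I_n -> E),
  (forall j, w j \in L) /\
  forall A A', \sum_j B A' j * gp_coset_act A (w j) = (A == A')%:R.
Proof.
have [n [w [B hB]]] := gal_dual_basis.
pose x j := \sum_(h in G') h (w j).
have xL j : x j \in L.
  apply: mem_fixed_galL => g gG; rewrite /x rmorph_sum /=.
  rewrite [RHS](reindex_inj (mulIg g)) /=; apply: eq_big => h; first by rewrite groupMr.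
  by rewrite gal_mul.
exists n, x, (fun A j => B (repr (val A)) j); split=> // A A'.
have [g ->] := gpX_class A; have [g' ->] := gpX_class A' => /=.
under eq_bigr => j _ do
  rewrite (coset_act_class _ (xL j)) rmorph_sum mulr_sumr.
rewrite exchange_big /=.
under eq_bigr => h _ do under eq_bigr => j _ do rewrite -gal_mul.
under eq_bigr => h _ do rewrite hB.
set r := repr _; have rg : r \in (G' :* g')%g by apply: mem_repr_rcoset.
have -> : (gp_class L g == gp_class L g') = (r * g^-1 \in G')%g.
  rewrite -mem_rcoset -val_eqE /=; apply/eqP/idP => [-> //|].
  by move=> rg1; rewrite -(rcoset_eqP rg) -(rcoset_eqP rg1).
have [inG|ninG] := boolP (_ \in _).
  rewrite (bigD1 (r * g^-1)%g) //= mulgKV eqxx big1 ?addr0 // => h /andP[_ nh].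
  by rewrite (can2_eq (mulgK g) (mulgKV g)) (negPf nh).
apply: big1 => h hG; case: eqP => // hr; case/negP: ninG.
by rewrite -hr mulgK.
Qed.

(** * The fixed algebra H and the embedding of L in E[N] *)

Section Structure.

Variable N : {group {perm X}}.
Hypotheses (N_regular : gp_regular N) (N_normalised : gp_normalised N).

Local Notation S := (subg_of N).

Lemma sgval_inj (n m : S) : sgval n = sgval m -> n = m.
Proof. exact: val_inj. Qed.

Lemma conj_lambda g (n : S) : (sgval n ^ gp_lambda L g)%g \in N.
Proof.
have /normP <- : gp_lambda L g \in ('N(N))%g.
  by apply: (subsetP N_normalised); apply: imset_f; apply: in_galG.
by rewrite memJ_conjg subgP.
Qed.

Definition conjN g (n : S) : S := subg N (sgval n ^ gp_lambda L g)%g.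

Lemma sgval_conjN g n : sgval (conjN g n) = (sgval n ^ gp_lambda L g)%g.
Proof. by rewrite subgK // conj_lambda. Qed.

Lemma conjN_comp g h n : conjN g (conjN h n) = conjN (h * g)%g n.
Proof. by apply: sgval_inj; rewrite !sgval_conjN gp_lambdaM conjgM. Qed.

Lemma conjN1 n : conjN 1%g n = n.
Proof.
apply: sgval_inj; rewrite sgval_conjN.
have -> : gp_lambda L 1%g = 1%g; last by rewrite conjg1.
by apply/permP => A; rewrite gp_lambdaE perm1; apply: val_inj; rewrite /= mulg1.
Qed.

Lemma conjNK g : cancel (conjN g) (conjN g^-1%g).
Proof. by move=> n; rewrite conjN_comp mulgV conjN1. Qed.

Lemma conjNVK g : cancel (conjN g^-1%g) (conjN g).
Proof. by move=> n; rewrite conjN_comp mulVg conjN1. Qed.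

Lemma conjNM g n m : conjN g (n * m)%g = (conjN g n * conjN g m)%g.
Proof. by apply: sgval_inj; rewrite /= !sgval_conjN /= conjMg. Qed.

Lemma grp_alg_galE g (c : grp_alg N) m : grp_alg_gal g c m = g (c (conjN g^-1%g m)).
Proof.
rewrite ffunE (bigD1 (conjN g^-1%g m)) /=; last by rewrite -sgval_conjN conjNVK.
rewrite big1 ?addr0 // => n /andP[/eqP nm]; case/eqP.
by rewrite -(conjNK g n); congr conjN; apply: sgval_inj; rewrite sgval_conjN.
Qed.

Lemma lambda_regular g (n : S) (A : X) :
  gp_lambda L g (sgval n A) = sgval (conjN g n) (gp_lambda L g A).
Proof. by rewrite sgval_conjN conjgE !permM permK. Qed.

Lemma orbit_bij (A : X) : exists n : S, sgval n (gp_class L 1%g) = A.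
Proof.
have [_ /atransP/(_ (gp_class L 1%g) (in_setT _)) tr] := N_regular.
have /orbitP[n nN <-] : A \in orbit 'P N (gp_class L 1%g) by rewrite tr inE.
by exists (subg N n); rewrite subgK.
Qed.

Lemma orbit_inj : injective (fun n : S => sgval n (gp_class L 1%g)).
Proof.
set f := fun n : S => _; suff /imset_injP fi : #|f @: [set: S]| == #|[set: S]|.
  by move=> n m; apply: fi; rewrite inE.
have -> : f @: [set: S] = [set: X].
  apply/setP => A; rewrite inE; have [n <-] := orbit_bij A.
  by rewrite imset_f ?inE.
by rewrite !cardsT -(proj1 N_regular) card_sub.
Qed.

(** The sum of the G-conjugates of the element x n of E[N], a source of elements of H. *)
Definition gal_trace (x : E) (n : S) : grp_alg N :=
  [ffun m => \sum_(g : gal_of {:E}) g x *+ (conjN g n == m)].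

Lemma gpH_gal_trace x n : gpH (gal_trace x n).
Proof.
move=> g _; apply/ffunP => m; rewrite grp_alg_galE !ffunE rmorph_sum /=.
rewrite [RHS](reindex_inj (mulIg g)) /=; apply: eq_bigr => h _.
rewrite raddfMn gal_mul -conjN_comp; congr (_ *+ _).
by rewrite (can2_eq (conjNK g) (conjNVK g)).
Qed.

Lemma gal_trace_mul x n y m k : grp_alg_mul (gal_trace x n) (gal_trace y m) k =
  \sum_(g : gal_of {:E})
    (\sum_(h : gal_of {:E}) h y *+ ((conjN h m * conjN g n)%g == k)) * g x.
Proof.
rewrite ffunE.
transitivity (\sum_(n1 : S) gal_trace x n n1 * gal_trace y m (k * n1^-1)%g).
  apply: eq_bigr => n1 _; rewrite (bigD1 (k * n1^-1)%g) /= ?mulgKV ?eqxx //.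
  rewrite big1 ?addr0 // => n2 /andP[/eqP <-]; by rewrite mulgK eqxx.
under eq_bigr => n1 _ do rewrite !ffunE mulr_suml.
rewrite exchange_big /=; apply: eq_bigr => g _.
rewrite (bigD1 (conjN g n)) //= eqxx mulr1n [X in _ + X]big1 ?addr0 => [|l nl]; last first.
  by rewrite eq_sym (negPf nl) mul0r.
rewrite mulrC; congr (_ * _); apply: eq_bigr => h _; congr (_ *+ _).
by rewrite -(inj_eq (mulIg (conjN g n)) (conjN h m)) mulgKV.
Qed.

(** The commutator of the traces of x n and y m vanishes for all x and y. In its coefficient at n m,
    independence of automorphisms, applied in x and then in y, isolates the term g = h = 1, which
    compares m n with n m. *)
Lemma gpH_commutative_mulC : gpH_commutative N -> commutative (@mulg S).
Proof.
move=> Hc n m; set k := (n * m)%g.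
have eq1 x y : \sum_(g : gal_of {:E}) (\sum_(h : gal_of {:E})
   (((conjN h m * conjN g n)%g == k)%:R - ((conjN g n * conjN h m)%g == k)%:R) * h y) * g x = 0.
  have /ffunP/(_ k) := Hc _ _ (gpH_gal_trace x n) (gpH_gal_trace y m).
  rewrite !gal_trace_mul.
  have -> : \sum_(h : gal_of {:E})
      (\sum_(g : gal_of {:E}) g x *+ ((conjN g n * conjN h m)%g == k)) * h y =
    \sum_(g : gal_of {:E})
      (\sum_(h : gal_of {:E}) h y *+ ((conjN g n * conjN h m)%g == k)) * g x.
    under eq_bigr => h _ do rewrite mulr_suml.
    rewrite exchange_big /=; apply: eq_bigr => g _; rewrite mulr_suml.
    by apply: eq_bigr => h _; rewrite !mulrnAl mulrC.
  move=> /eqP; rewrite -subr_eq0 => /eqP E0; rewrite -[RHS]E0 -sumrB; apply: eq_bigr => g _.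
  rewrite -mulrBl -sumrB; congr (_ * _); apply: eq_bigr => h _.
  by rewrite mulrBl !mulr_natl.
have eq2 y : \sum_(h : gal_of {:E})
   (((conjN h m * conjN 1 n)%g == k)%:R - ((conjN 1 n * conjN h m)%g == k)%:R) * h y = 0.
  pose c_ g := \sum_(h : gal_of {:E})
   (((conjN h m * conjN g n)%g == k)%:R - ((conjN g n * conjN h m)%g == k)%:R) * h y.
  by apply: (gal_independent (c_ := c_) (P := xpredT)) => // x _; apply: eq1.
pose d_ h : E :=
  ((conjN h m * conjN 1 n)%g == k)%:R - ((conjN 1 n * conjN h m)%g == k)%:R.
have : d_ 1%g = 0.
  by apply: (gal_independent (c_ := d_) (P := xpredT)) => // y _; apply: eq2.
rewrite /d_ !conjN1 /k eqxx; case: eqP => [->//|_] /eqP.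
by rewrite sub0r oppr_eq0 oner_eq0.
Qed.

Hypothesis gC : commutative (@mulg S).
Local Notation A := (cgalg E gC).

Definition gam g (c : A) : A := mk_galg gC (fun m => g (gcoef c (conjN g^-1%g m))).

Lemma gcoef_gam g c m : gcoef (gam g c) m = g (gcoef c (conjN g^-1%g m)).
Proof. exact: gcoef_mk. Qed.

Lemma gamD g a b : gam g (a + b) = gam g a + gam g b.
Proof. by apply: gcoefP => m; rewrite gcoefD !gcoef_gam gcoefD rmorphD. Qed.

Lemma gamN g a : gam g (- a) = - gam g a.
Proof. by apply: gcoefP => m; rewrite gcoefN !gcoef_gam gcoefN rmorphN. Qed.

Lemma conjNV g n : conjN g n^-1%g = (conjN g n)^-1%g.
Proof. by apply: sgval_inj; rewrite sgval_conjN /= sgval_conjN conjVg. Qed.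

Lemma gamM g a b : gam g (a * b) = gam g a * gam g b.
Proof.
apply: gcoefP => m; rewrite gcoefM gcoef_gam gcoefM rmorph_sum /=.
rewrite [RHS](reindex_inj (can_inj (conjNK g))) /=; apply: eq_bigr => n _.
rewrite rmorphM !gcoef_gam conjNK; congr (_ * g (gcoef _ _)).
by rewrite conjNM conjNV conjNK.
Qed.

Lemma gam1 g : gam g 1 = 1.
Proof.
apply: gcoefP => m; rewrite gcoef_gam -mono1 !gcoef_mono rmorphMn rmorph1.
congr (_ *+ nat_of_bool _); rewrite -[LHS](inj_eq (can_inj (conjNK g))) conjNVK.
by congr (_ == _); apply: sgval_inj; rewrite sgval_conjN /= conj1g.
Qed.

Lemma gpH_gam (c : A) : gpH c <-> forall g, gam g c = c.
Proof.
split=> [Hc g | Hc g _].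
  apply: gcoefP => m; rewrite gcoef_gam.
  by have /ffunP/(_ m) := Hc g (in_galG g); rewrite grp_alg_galE.
apply/ffunP => m; rewrite grp_alg_galE.
by have /(congr1 (fun d : A => gcoef d m)) := Hc g; rewrite gcoef_gam.
Qed.

(** The conjugates of [x] under the embeddings of L, indexed by N through its simply transitive
    action on the cosets. *)
Definition gembed x : A :=
  mk_galg gC (fun n : S => gp_coset_act (sgval n (gp_class L 1%g)) x).

Lemma gcoef_embed x n : gcoef (gembed x) n = gp_coset_act (sgval n (gp_class L 1%g)) x.
Proof. exact: gcoef_mk. Qed.

Lemma gembedD x y : gembed (x + y) = gembed x + gembed y.
Proof. by apply: gcoefP => n; rewrite gcoefD !gcoef_embed /gp_coset_act rmorphD. Qed.

(** Reindexing by conjugation leaves the coefficients unchanged, because [c] is fixed, and moves the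
    base point from the class of 1 to that of [g]. *)
Lemma gal_gpH_act g (c : A) x : gpH c -> x \in L ->
  g (gpH_act c x) =
  \sum_(n : S) gcoef c n * gp_coset_act (sgval n^-1%g (gp_class L g)) x.
Proof.
move=> Hc xL; rewrite rmorph_sum /= [RHS](reindex_inj (can_inj (conjNK g))) /=.
apply: eq_bigr => n _; rewrite rmorphM /= coset_act_lambda //.
rewrite -[((sgval n)^-1)%g]/(sgval n^-1%g) lambda_regular conjNV.
rewrite gp_lambdaE gp_translate_class mul1g; congr (_ * _).
by have /gpH_gam/(_ g) Eg := Hc; rewrite -[in RHS]Eg gcoef_gam conjNK.
Qed.

Lemma gpH_act_memL (c : A) x : gpH c -> x \in L ->
  gpH_act c x \in L.
Proof.
move=> Hc xL; apply: mem_fixed_galL => g gG; rewrite gal_gpH_act //.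
have -> // : gp_class L g = gp_class L 1%g.
by apply: val_inj; rewrite /= mulg1 rcoset_id.
Qed.

Lemma gembed_act (c : A) x : gpH c -> x \in L ->
  gembed (gpH_act c x) = c * gembed x.
Proof.
move=> Hc xL; apply: gcoefP => k; rewrite gcoef_embed gcoefM.
have [g gE] := gpX_class (sgval k (gp_class L 1%g)).
rewrite gE coset_act_class ?gpH_act_memL // gal_gpH_act // -gE.
by apply: eq_bigr => n _; rewrite gcoef_embed gC /= permM.
Qed.

Lemma gembed_inj : {in L &, injective gembed}.
Proof.
move=> x y xL yL /(congr1 (fun d : A => gcoef d 1%g)).
by rewrite !gcoef_embed /= perm1 !coset_act_class // !gal_id.
Qed.

(* L is a twisted form of E[N]: the Galois action on its image in E[N] is    *)
(* translation by an element of N that depends on g only.                    *)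
Lemma gam_embed g : exists t, forall x, x \in L -> gam g (gembed x) = mono gC 1 t * gembed x.
Proof.
have [t tE] := orbit_bij (gp_class L g); exists t^-1%g => x xL.
apply: gcoefP => m; rewrite gcoefM (bigD1 t^-1%g) //= big1 ?addr0 => [|l nl].
  rewrite gcoef_mono eqxx mul1r invgK gcoef_gam !gcoef_embed coset_act_lambda //.
  by rewrite lambda_regular conjNVK /= permM tE gp_lambdaE gp_translate_class mul1g.
by rewrite gcoef_mono (negPf nl) mul0r.
Qed.

(** By [gam_embed] each [g] multiplies numerator and denominator by the same group element, so the
    quotient is fixed. *)
Lemma gpH_div x y (d : A) : x \in L -> y \in L -> d * gembed x = 1 ->
  gpH (gembed y * d).
Proof.
move=> xL yL dx; apply/gpH_gam => g; have [t tE] := gam_embed g.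
have dE : gam g d * mono gC 1 t = d.
  by rewrite -[LHS]mulr1 -dx mulrCA -[RHS]mulr1; congr (_ * _);
     rewrite -mulrA -tE // -gamM dx gam1.
by rewrite gamM tE // mulrC mulrA dE mulrC.
Qed.

Lemma gpH1 : gpH (1 : A).
Proof. by apply/gpH_gam => g; rewrite gam1. Qed.

Lemma gpHD (a b : A) : gpH a -> gpH b -> gpH (a + b).
Proof. by move=> /gpH_gam Ha /gpH_gam Hb; apply/gpH_gam => g; rewrite gamD Ha Hb. Qed.

Lemma gpHN (a : A) : gpH a -> gpH (- a).
Proof. by move=> /gpH_gam Ha; apply/gpH_gam => g; rewrite gamN Ha. Qed.

Lemma gpHM (a b : A) : gpH a -> gpH b -> gpH (a * b).
Proof. by move=> /gpH_gam Ha /gpH_gam Hb; apply/gpH_gam => g; rewrite gamM Ha Hb. Qed.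

Lemma gpHV (a b : A) : gpH a -> b * a = 1 -> gpH b.
Proof.
move=> /gpH_gam Ha ba; apply/gpH_gam => g; rewrite -[LHS]mulr1 -ba mulrCA.
by rewrite -(Ha g) -gamM ba gam1 mulr1.
Qed.

Definition galg_act (c : A) x : E := gpH_act c x.

Lemma galg_actM (a b : A) x : gpH a -> gpH b -> x \in L ->
  galg_act (a * b) x = galg_act a (galg_act b x).
Proof.
move=> Ha Hb xL; have Hab := gpHM Ha Hb.
apply: gembed_inj; rewrite ?gpH_act_memL //.
rewrite (gembed_act Hab xL) gembed_act ?gpH_act_memL //.
by rewrite gembed_act // mulrA.
Qed.

End Structure.

End GaloisSide.

(** * Freeness over the associated order *)

Lemma nonneg_of_quotients (C y : rat) :
  (forall m : nat, C / m.+1%:R <= y) -> 0 <= y.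
Proof.
move=> h; rewrite leNgt; apply/negP => y0.
have [m hm] := rat_lt_nat (C / y); have := h m.
rewrite ler_pdivrMr ?ltr0n // -natr1 mulrDr mulr1.
by move: hm; rewrite ltr_ndivrMr // [m%:R * _]mulrC; lra.
Qed.

(** * Specialising coefficients to natural numbers *)

Section NonvanishingDeterminant.

Variables (E : fieldType) (charE : [pchar E] =i pred0) (n : nat).

Lemma poly_nat_nonroot (q : {poly E}) : q != 0 -> exists k : nat, q.[k%:R] != 0.
Proof.
move=> q0; apply: NNPP => /not_ex_all_not h.
pose rs : seq E := [seq k%:R | k <- iota 0 (size q)].
have : (size rs < size q)%N.
  apply: max_poly_roots q0 _ _.
    apply/allP => _ /mapP[k _ ->]; rewrite rootE.
    by apply/negPn/negP => /h.
  rewrite map_inj_uniq ?iota_uniq // => k l.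
  wlog le : k l / (k <= l)%N.
    by move=> W; have [/W|/ltnW/W W' /esym/W'] := leqP k l.
  move=> /eqP; rewrite eq_sym -subr_eq0 -natrB // => /eqP e.
  have := (pcharf0P E).1 charE (l - k)%N; rewrite e eqxx => /esym; lia.
by rewrite size_map size_iota ltnn.
Qed.

Lemma det_nat_scale (B M : 'M[E]_n) (a : E) : \det (B + a *: M) != 0 ->
  exists k : nat, \det (B + k%:R *: M) != 0.
Proof.
pose Q := \det (map_mx polyC B + 'X *: map_mx polyC M).
have QE s : Q.[s] = \det (B + s *: M).
  rewrite -[_.[s]]/(horner_eval s Q) -det_map_mx; congr (\det _).
  by apply/matrixP => i j; rewrite !mxE /= horner_evalE !hornerE.
rewrite -QE => Qa; have [|k] := @poly_nat_nonroot Q; last by exists k; rewrite -QE.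
by apply: contraNneq Qa => ->; rewrite horner0.
Qed.

(** The determinant is a polynomial in each coefficient, and in characteristic 0 a nonzero
    polynomial has a natural number as a nonroot; the coefficients are replaced one at a time. *)
Lemma det_nat_comb m (B : 'M[E]_n) (a : 'I_m -> E) (M : 'I_m -> 'M[E]_n) :
  \det (B + \sum_j a j *: M j) != 0 ->
  exists k : 'I_m -> nat, \det (B + \sum_j (k j)%:R *: M j) != 0.
Proof.
elim: m => [|m IHm] in B a M *.
  by rewrite !big_ord0 => d; exists (fun=> 0%N); rewrite big_ord0.
rewrite big_ord_recl addrA => /IHm[k]; rewrite addrAC => /det_nat_scale[k0 d].
exists (fun i => oapp k k0 (unlift ord0 i)); rewrite big_ord_recl unlift_none /=.
rewrite addrA addrAC; move: d; congr (is_true (\det (_ + _ + _) != 0)).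
by apply: eq_bigr => i _; rewrite liftK.
Qed.

End NonvanishingDeterminant.

(** * The associated order of a p-adic extension *)

Section Main.

Variables (p : nat) (p_prime : prime p).
Variables (Qp : fieldType) (v0 : Qp -> rat) (hQp : is_Qp p v0).
Variables (K : fieldExtType Qp) (E : splittingFieldType K) (L : {subfield E}).
Variables (v : E -> rat) (hv : extends_valuation v0 v) (galE : galois 1 {:E}).
Implicit Types (g h : gal_of {:E}) (x : E).

Let valv : valuation v := proj1 hv.

Lemma val_gal g x : x != 0 -> v (g x) = v x.
Proof.
move=> x0; have [n [e [e_free e_span]]] := basis_over_base E.
have valg : valuation (fun y => v (g y)).
  split=> [y z y0 z0|y z y0 z0 yz]; first by rewrite rmorphM (valuationM valv) ?fmorph_eq0.
  by rewrite rmorphD (valuationD valv) ?fmorph_eq0 // -rmorphD fmorph_eq0.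
apply: (val_extension_unique (Qp_complete hQp) e_free e_span valg valv _ _ x0) => a a0 /=.
  rewrite linearZ rmorph1; exact: (proj2 hv).
exact: (proj2 hv).
Qed.

Lemma val_ge_gal k g x : val_ge v k (g x) = val_ge v k x.
Proof.
have [->|x0] := eqVneq x 0; first by rewrite rmorph0.
by rewrite !val_geE ?fmorph_eq0 // val_gal.
Qed.

Lemma natr_tower n : n%:R = ((n%:R : Qp)%:A : K)%:A :> E.
Proof. by rewrite -!in_algE !rmorph_nat. Qed.

Lemma E_pchar0 : [pchar E] =i pred0.
Proof.
apply/pcharf0P => n; rewrite natr_tower -!in_algE !fmorph_eq0.
by have /pcharf0P-> := Qp_pchar0 hQp.
Qed.

Lemma E_p_neq0 : p%:R != 0 :> E.
Proof. by have /pcharf0P-> := E_pchar0; rewrite -lt0n prime_gt0. Qed.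

Lemma E_val_p : v p%:R = 1.
Proof.
have p0 : p%:R != 0 :> Qp by rewrite (Qp_nat_neq0 hQp) // prime_gt0.
rewrite natr_tower (proj2 hv) // (Qp_val_nat hQp) ?prime_gt0 //.
by rewrite lognE p_prime dvdnn prime_gt0 //= divnn prime_gt0 //= logn1.
Qed.

Lemma E_finite_classes : finite_classes v.
Proof.
have [n [e [e_free e_span]]] := basis_over_base E.
have p0 : p%:R != 0 :> Qp by rewrite (Qp_nat_neq0 hQp) // prime_gt0.
apply: (finite_classes_extension (Qp_valuation hQp) (Qp_complete hQp) e_free
  e_span valv (proj2 hv) p0 _ (Qp_finite_classes p_prime hQp)).
rewrite (Qp_val_nat hQp) ?prime_gt0 //.
by rewrite lognE p_prime dvdnn prime_gt0 //= divnn prime_gt0 //= logn1.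
Qed.

Lemma pX_integral (I : finType) (f : I -> E) :
  exists k : nat, forall i, val_ge v 0 (p%:R ^+ k * f i).
Proof.
have [C hC] : exists C : nat, forall i, i \in enum I -> - C%:R <= v (f i).
  elim: (enum I) => [|i s [C hC]]; first by exists 0.
  have [C' hC'] := rat_lt_nat (- v (f i)).
  have C0 : 0 <= C%:R :> rat by [].
  have C0' : 0 <= C'%:R :> rat by [].
  by exists (C + C')%N => j; rewrite inE natrD => /orP[/eqP->|/hC]; lra.
exists C => i; have [->|fi0] := eqVneq (f i) 0; first by rewrite mulr0 val_ge0.
rewrite val_geE ?mulf_neq0 ?expf_neq0 ?E_p_neq0 //.
rewrite (valuationM valv) ?expf_neq0 ?E_p_neq0 // (valuationX valv) ?E_p_neq0 // E_val_p.
by have := hC i (mem_enum _ _); lra.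
Qed.

Variable N : {group {perm gpX L}}.
Hypotheses (N_regular : gp_regular N) (N_normalised : gp_normalised N).
Hypothesis gC : commutative (@mulg (subg_of N)).
Hypothesis pL : ~~ (p %| \dim L)%N.
Local Notation A := (cgalg E gC).
Local Notation F := (gembed gC).

Lemma coprime_p_N : coprime p #|{: subg_of N}|.
Proof. by rewrite card_sub prime_coprime // (proj1 N_regular) (card_gpX _ galE). Qed.

Lemma cge_embed k x : x \in L -> cge v k (F x) <-> val_ge v k x.
Proof.
move=> xL; split=> [/(_ 1%g)|h n].
  by rewrite gcoef_embed /= perm1 coset_act_class // gal_id.
rewrite gcoef_embed; have [g ->] := gpX_class (sgval n (gp_class L 1%g)).
by rewrite coset_act_class // val_ge_gal.
Qed.

Lemma fixed_in_order (c : A) : int_grp_alg_fixed v c ->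
  assoc_order v c.
Proof.
move=> [ci Hc]; split=> // x /andP[xL xi].
have cxL : gpH_act c x \in L by apply: gpH_act_memL.
rewrite /int_ring_L /= cxL; apply/cge_embed => //.
rewrite (gembed_act galE N_normalised Hc xL).
by apply: (cge0M valv) => //; apply/cge_embed.
Qed.

(** The dual basis, rescaled so that the w_j are integral, writes each coefficient of [c] as a fixed
    combination of the integral elements c.w_j; denominators come from the dual basis alone. *)
Lemma assoc_order_bounded :
  exists C : rat, forall c : A, assoc_order v c -> cge v C c.
Proof.
have [n [w0 [B0 [w0L B0E]]]] := coset_dual_basis L galE.
have [k hk] := pX_integral w0.
pose w j := p%:R ^+ k * w0 j; pose B A j := p%:R ^- k * B0 A j.
have wi j : int_ring_L L v (w j).
  rewrite /int_ring_L /= [_ \in _]rpredM ?rpredX ?rpred_nat //=; exact: hk.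
have BE A A' : \sum_j B A' j * gp_coset_act A (w j) = (A == A')%:R.
  rewrite -B0E; apply: eq_bigr => j _; rewrite /gp_coset_act rmorphM rmorphXn rmorph_nat.
  by rewrite mulrACA mulVf ?mul1r // expf_neq0 // E_p_neq0.
have [l hl] := pX_integral (fun Aj : gpX L * 'I_n => B Aj.1 Aj.2).
exists (- l%:R) => c [Hc ac] m.
have -> : gcoef c m = \sum_j B (sgval m^-1%g (gp_class L 1%g)) j * gpH_act c (w j).
  under eq_bigr => j _ do rewrite /gpH_act mulr_sumr.
  rewrite exchange_big (bigD1 m) //= [X in _ + X]big1 ?addr0 => [|i im].
    under eq_bigr => j _ do rewrite mulrCA.
    by rewrite -mulr_sumr BE eqxx mulr1.
  under eq_bigr => j _ do rewrite mulrCA.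
  rewrite -mulr_sumr BE; case: eqP; rewrite ?mulr0 // => eqo.
  have := orbit_inj N_regular (eqo : sgval i^-1%g _ = sgval m^-1%g _).
  by move=> /invg_inj eim; rewrite eim eqxx in im.
apply: val_ge_sum => // j _; rewrite -[- _]addr0; apply: val_geM => //; last first.
  by have /andP[_] := ac _ (wi j).
have := hl (sgval m^-1%g (gp_class L 1%g), j) => /=.
by rewrite val_ge_Vl ?expf_neq0 ?E_p_neq0 // (valuationX valv) ?E_p_neq0 // E_val_p sub0r.
Qed.

Lemma order_integral (c : A) : assoc_order v c -> cge v 0 c.
Proof.
move=> ac; have [C hC] := assoc_order_bounded.
have acX m (d : A) : d = c ^+ m.+1 -> assoc_order v d.
  elim: m d => [|m IHm] d; first by rewrite expr1 => ->.
  have [Hm am] := IHm _ erefl; have [Hc ac'] := ac.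
  rewrite exprS => ->; split=> [|x xi]; first exact: gpHM.
  have xL : x \in L by case/andP: xi.
  rewrite -[gpH_act _ x]/(galg_act (c * c ^+ m.+1) x).
  by rewrite (galg_actM galE N_normalised Hc Hm xL); apply/ac'/am.
have root m : cge v (C / m.+1%:R) c.
  apply: (cge_root valv p_prime E_p_neq0 E_val_p coprime_p_N (ltn0Sn m)).
  by rewrite -(mulr_natr (C / _)) divfK ?pnatr_eq0 //; apply: hC; apply: acX erefl.
have [->|/(cge_exact v)[n cn0 hc]] := eqVneq c 0; first exact: cge0.
apply: cgeW hc; apply: (@nonneg_of_quotients C) => m.
by rewrite -(val_geE v _ cn0); apply: root.
Qed.

Lemma assoc_orderE (c : A) :
  assoc_order v c <-> gpH c /\ cge v 0 c.
Proof.
split=> [ac|[Hc ci]]; last exact: fixed_in_order.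
by split; [case: ac | apply: order_integral].
Qed.

(** The dual basis gives an E-combination of the [F (w j)] equal to 1, whose multiplication matrix
    is invertible. Coefficients in E would leave the image of L, but natural number coefficients, as
    provided by [det_nat_comb], do not. *)
Lemma unit_embed : exists x (d : A), x \in L /\ d * F x = 1.
Proof.
have [n [w [B [wL BE]]]] := coset_dual_basis L galE.
have E1 : \sum_j mono gC (B (gp_class L 1%g) j) 1%g * F (w j) = 1.
  apply: gcoefP => m; rewrite gcoef_sum -mono1 gcoef_mono.
  under eq_bigr => j _ do rewrite gcoef_mono1M gcoef_embed.
  rewrite BE; congr (nat_of_bool _)%:R; apply/eqP/eqP => [eqm|-> /=]; last by rewrite perm1.
  by apply: (orbit_inj N_regular); rewrite eqm /= perm1.
have [|k] := det_nat_comb E_pchar0 (B := 0) (a := B (gp_class L 1%g))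
    (M := fun j => mul_mx (F (w j))).
  rewrite add0r; have -> : \sum_j B (gp_class L 1%g) j *: mul_mx (F (w j)) =
    mul_mx (\sum_j mono gC (B (gp_class L 1%g) j) 1%g * F (w j)).
    rewrite (big_morph (@mul_mx _ _ gC) (@mul_mxD _ _ gC) (id1 := 0)).
      by apply: eq_bigr => j _; rewrite mul_mx_mono1M.
    by apply/matrixP => i j; rewrite !mxE gcoef0.
  by rewrite E1 mul_mx1 det1 oner_neq0.
rewrite add0r; have -> : \sum_j (k j)%:R *: mul_mx (F (w j)) = mul_mx (F (\sum_j w j *+ k j)).
  have F0 : F 0 = 0.
    by apply: gcoefP => m; rewrite gcoef0 gcoef_embed /gp_coset_act rmorph0.
  rewrite (big_morph (fun x => mul_mx (F x)) (id1 := 0) (op1 := +%R)).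
  - apply: eq_bigr => j _; rewrite -mul_mx_mono1M; congr mul_mx.
    apply: gcoefP => m; rewrite gcoef_mono1M !gcoef_embed /gp_coset_act rmorphMn.
    by rewrite mulr_natl.
  - by move=> x y; rewrite gembedD mul_mxD.
  - by rewrite F0; apply/matrixP => i j; rewrite !mxE gcoef0.
move=> /galg_unit[d dE]; exists (\sum_j w j *+ k j), d; split=> //.
by apply: rpred_sum => j _; apply: rpredMn.
Qed.

Lemma free_assoc_order : free_over_assoc_order N v.
Proof.
have [x0 [d0 [x0L d0E]]] := unit_embed.
pose H (c : A) := gpH c; pose M (c : A) := exists2 x, x \in L & c = F x.
have MD a b : M a -> M b -> M (a + b).
  move=> [x xL ->] [y yL ->]; exists (x + y); rewrite ?gembedD //.
  exact: rpredD.
have HMM a b : H a -> M b -> M (a * b).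
  move=> Ha [x xL ->]; exists (gpH_act a x); first exact: gpH_act_memL.
  by rewrite gembed_act.
have Mdiv u y d : M u -> M y -> d * u = 1 -> H (y * d).
  by move=> [x xL ->] [z zL ->]; apply: gpH_div.
have Mx0 : M (F x0) by exists x0.
have [_ [d [[b bL ->] b0 dE hd]]] := free_lattice valv p_prime E_p_neq0 E_val_p
  coprime_p_N E_finite_classes (gpH1 N_normalised gC) (gpHD N_normalised (gC := gC))
  (gpHN N_normalised (gC := gC)) (gpHM N_normalised (gC := gC))
  (gpHV N_normalised (gC := gC)) MD HMM Mdiv Mx0 d0E.
have bi : int_ring_L L v b by rewrite /int_ring_L /= bL; apply/cge_embed.
(* A basis of one element: the coefficient of [x] is the quotient of [F x] by the unit [F b], which
   also gives uniqueness. *)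
exists 1%N, (fun=> b); split=> // x xi; have /andP[xL x0'] := xi.
pose a : A := F x * d.
have Ha : gpH a by apply: gpH_div dE.
have ax : x = gpH_act a b.
  apply: (gembed_inj (gC := gC)) => //; first exact: gpH_act_memL.
  by rewrite gembed_act // /a -mulrA dE mulr1.
exists [ffun=> a]; split.
  split=> [i|]; last by rewrite big_ord1 ffunE.
  rewrite ffunE; apply/assoc_orderE; split=> //.
  by apply: hd; [exists x | apply/cge_embed].
move=> a' [Ha' xE]; apply/ffunP => i; rewrite ffunE (ord1 i).
move: xE; rewrite big_ord1 => xE; have [Hc _] := Ha' ord0.
suff : a = (a' ord0 : A) by [].
have : F x = (a' ord0 : A) * F b by rewrite {1}xE gembed_act.
by rewrite /a => ->; rewrite -mulrA [F b * d]mulrC dE mulr1.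
Qed.

End Main.

Local Close Scope ring_scope.

Theorem theorem4p4 (p : nat) (p_prime : prime p)
    (Qp : fieldType) (v0 : Qp -> rat) (hQp : is_Qp p v0)
    (K : fieldExtType Qp) (E : splittingFieldType K) (L : {subfield E})
    (v : E -> rat) (hv : extends_valuation v0 v) (hE : galois_closure L)
    (N : {group {perm gpX L}}) (N_regular : gp_regular N)
    (N_normalised : gp_normalised N) (H_comm : gpH_commutative N)
    (p_ndvd : ~~ (p %| \dim L)) :
  (forall h : grp_alg N, assoc_order v h <-> int_grp_alg_fixed v h) /\
  free_over_assoc_order N v.
Proof.
have [galE _] := hE.
have gC := gpH_commutative_mulC N_normalised H_comm.
split; last exact: (free_assoc_order p_prime hQp hv galE N_regular N_normalised gC p_ndvd).
move=> h; split=> [ah|]; last exact: (fixed_in_order hQp hv galE N_normalised (gC := gC) (c := h)).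
split; last by case: ah.
exact: (order_integral p_prime hQp hv galE N_regular N_normalised (gC := gC) p_ndvd ah).
Qed.
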